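(* Let $F=\mathbb{F}(n;n_1,\dots,n_k)=SU(n)/S(U(n_1)\times\cdots\times U(n_k))$ with $n=n_1+\cdots+n_k$, and let $X\in\mathfrak{m}\cong T_oF$ be a tangent vector at the origin. Then $X$ is an equigeodesic vector if and only if $[X,\Lambda X]_{\mathfrak{m}}=0$ for every invariant metric $\Lambda$ on $F$.
   Context: Let $G=SU(n)$, $K=S(U(n_1)\times\cdots\times U(n_k))$ (block-diagonal matrices in $SU(n)$, $n_i\ge 1$), with Lie algebras $\mathfrak{g}=\mathfrak{su}(n)$ and $\mathfrak{k}$, and let $o=eK$. Let $\langle\cdot,\cdot\rangle$ be the Cartan-Killing form of $\mathfrak{g}$ and $\mathfrak{m}=\mathfrak{k}^{\perp}$, so that $\mathfrak{g}=\mathfrak{k}\oplus\mathfrak{m}$; $\mathfrak{m}$ consists of the skew-Hermitian $n\times n$ matrices $A=(a_{ij})_{1\le i,j\le k}$, $a_{ij}\in M_{n_i,n_j}(\mathbb{C})$, with all diagonal blocks $a_{ii}=0$, and is identified with $T_oF$. For $Y\in\mathfrak{g}$, $Y_{\mathfrak{m}}$ denotes the $\mathfrak{m}$-component of $Y$. An invariant metric on $F$ is a $G$-invariant Riemannian metric $g$; it is determined by an operator $\Lambda:\mathfrak{m}\to\mathfrak{m}$ via $g_o(X,Y)=-\langle\Lambda X,Y\rangle$. The operators arising are those of the form $(\Lambda A)_{ij}=\lambda_{ij}a_{ij}$ for $i\ne j$, where $\lambda_{ij}=\lambda_{ji}>0$ are arbitrary positive reals. By abuse of language $\Lambda$ itself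 is called an invariant metric. A vector $X$ is called an equigeodesic vector if the curve $\gamma(t)=(\exp tX)\cdot o$ is a geodesic of $F$ with respect to every invariant metric (constant curves are counted as geodesics). *)

(* Defs.v *)
From HB Require Import structures.
From mathcomp Require Export all_boot all_order all_algebra.
From mathcomp Require Export complex.
From mathcomp Require Export all_classical all_reals all_analysis.

Set Implicit Arguments.
Unset Strict Implicit.
Unset Printing Implicit Defensive.

Import Order.TTheory GRing.Theory Num.Theory.
Import numFieldNormedType.Exports.

Local Open Scope classical_set_scope.
Local Open Scope ring_scope.
Local Open Scope complex_scope.
Local Open Scope sesquilinear_scope.

Section Smoothness.
Variables (R : realType) (V : normedModType R).

(* Class C^m on an open set A. *)
Fixpoint Ck_on (m : nat) (A : set V) (f : V -> R) : Prop :=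
  match m with
  | 0 => forall x, A x -> {for x, continuous f}
  | m'.+1 => (forall x, A x -> differentiable f x) /\
             (forall v, Ck_on m' A (fun x => 'D_v f x))
  end.

Definition smooth_on (A : set V) (f : V -> R) : Prop :=
  forall m, Ck_on m A f.

Definition smooth_on_cmx (n : nat) (A : set V) (f : V -> 'M[R[i]]_n) : Prop :=
  forall a b, smooth_on A (fun x => complex.Re (f x a b)) /\
              smooth_on A (fun x => complex.Im (f x a b)).

Definition derive_cmx (n : nat) (f : V -> 'M[R[i]]_n) (x v : V) : 'M[R[i]]_n :=
  \matrix_(a, b) ('D_v (fun y => complex.Re (f y a b)) x
                  +i* 'D_v (fun y => complex.Im (f y a b)) x).

End Smoothness.

Section RiemannianGeometryInCoordinates.
Variables (R : realType) (N : nat).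

Definition partial (i : 'I_N) (f : 'rV[R]_N -> R) (x : 'rV[R]_N) : R :=
  'D_(delta_mx 0 i) f x.

(* Christoffel symbols Gamma^c_ab of the Levi-Civita connection; h x is the
   Gram matrix of the metric at x in the coordinate frame. *)
Definition christoffel (h : 'rV[R]_N -> 'M[R]_N) (x : 'rV[R]_N)
    (c a b : 'I_N) : R :=
  2^-1 * \sum_(l < N) invmx (h x) c l *
    (partial a (fun y => h y b l) x + partial b (fun y => h y a l) x
     - partial l (fun y => h y a b) x).

Definition geodesic_eq_at (h : 'rV[R]_N -> 'M[R]_N) (x : R -> 'rV[R]_N)
    (t : R) : Prop :=
  forall c : 'I_N,
    derive1 (derive1 (fun s => x s 0 c)) t
    + \sum_(a < N) \sum_(b < N) christoffel h (x t) c a b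
        * derive1 (fun s => x s 0 a) t
        * derive1 (fun s => x s 0 b) t = 0.

End RiemannianGeometryInCoordinates.

Section MatrixExponential.
Variables (R : realType) (n : nat).

Definition expmx_partial (A : 'M[R[i]]_n) (m : nat) : 'M[R[i]]_n :=
  \sum_(0 <= l < m) (l`!%:R)^-1 *: A ^+ l.

Definition expmx (A : 'M[R[i]]_n) : 'M[R[i]]_n :=
  \matrix_(a, b)
    (limn (fun m => complex.Re (expmx_partial A m a b))
     +i* limn (fun m => complex.Im (expmx_partial A m a b))).

Definition lie_bracket (A B : 'M[R[i]]_n) : 'M[R[i]]_n := A *m B - B *m A.

Definition inSU (a : 'M[R[i]]_n) : Prop := (a \is unitarymx) /\ \det a = 1.

Definition in_su (A : 'M[R[i]]_n) : Prop := A ^t* = - A /\ \tr A = 0.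

(* The Cartan-Killing form tr (ad A o ad B) of su(n).  The trace is taken over
   gl(n, C) = (su(n) (x) C) (+) C.1; the centre contributes 0 to it. *)
Definition killing (A B : 'M[R[i]]_n) : R :=
  complex.Re (\tr (lin_mx (fun Z => lie_bracket A (lie_bracket B Z)))).

End MatrixExponential.

Section FlagManifold.
Variables (R : realType) (k : nat) (p : 'I_k -> nat).

Local Notation mat := 'M[R[i]]_(\sum_(i < k) p i).

Definition block_diagonal (A : mat) : Prop :=
  forall i j : 'I_k, i != j -> submxblock A i j = 0.

Definition inK (a : mat) : Prop := inSU a /\ block_diagonal a.

Definition in_k (A : mat) : Prop := in_su A /\ block_diagonal A.

Definition in_m (A : mat) : Prop :=
  in_su A /\ (forall B, in_k B -> killing A B = 0).

(* For A in su(n), the k-component in su(n) = k (+) m is the block-diagonal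
   part of A (it is traceless, as A is). *)
Definition m_part (A : mat) : mat :=
  \mxblock_(i < k, j < k) (if i == j then 0 else submxblock A i j).

(* The point a.o of F = SU(n)/K. *)
Definition coset (a : mat) : set mat := [set a *m h | h in inK].

(* The tangent bundle of F is SU(n) x_K m: for a in SU(n) and Y in m, the
   pair (a, Y) represents the image a_* Y in T_{a.o} F of Y in m = T_o F under
   the differential of the left translation by a, and
   (a h)_* Y = a_* (h Y h^-1) for h in K.
   A metric is given by g a Y Z = g_{a.o}(a_* Y, a_* Z). *)
Record riemannian_metric (g : mat -> mat -> mat -> R) : Prop := {
  metric_linear : forall a Y Y' Z (c : R),
    inSU a -> in_m Y -> in_m Y' -> in_m Z ->
    g a (c%:C *: Y + Y') Z = c * g a Y Z + g a Y' Z;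
  metric_sym : forall a Y Z,
    inSU a -> in_m Y -> in_m Z -> g a Y Z = g a Z Y;
  metric_pos : forall a Y,
    inSU a -> in_m Y -> Y != 0 -> 0 < g a Y Y;
  metric_well_defined : forall a h Y Z,
    inSU a -> inK h -> in_m Y -> in_m Z ->
    g (a *m h) Y Z = g a (h *m Y *m invmx h) (h *m Z *m invmx h);
  metric_smooth : forall N (U : set 'rV[R]_N) (phi : 'rV[R]_N -> mat) Y Z,
    open U -> smooth_on_cmx U phi -> (forall x, U x -> inSU (phi x)) ->
    in_m Y -> in_m Z -> smooth_on U (fun x => g (phi x) Y Z)
}.

(* The left translation by b maps a_* Y to (b a)_* Y. *)
Definition invariant_metric (g : mat -> mat -> mat -> R) : Prop :=
  riemannian_metric g /\
  (forall a b Y Z, inSU a -> inSU b -> in_m Y -> in_m Z ->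
     g (b *m a) Y Z = g a Y Z).

(* If phi is SU(n)-valued, the differential at x of x |-> (phi x).o maps u to
   (phi x)_* (coord_velocity phi x u). *)
Definition coord_velocity (N : nat) (phi : 'rV[R]_N -> mat) (x u : 'rV[R]_N) :
    mat :=
  m_part (invmx (phi x) *m derive_cmx phi x u).

(* Local coordinates on F: x |-> (phi x).o is a local diffeomorphism from U
   to F, given through a smooth lift phi to SU(n) (local lifts exist because
   SU(n) -> F is a principal bundle). *)
Record local_coordinates (N : nat) (U : set 'rV[R]_N)
    (phi : 'rV[R]_N -> mat) : Prop := {
  coords_open : open U;
  coords_smooth : smooth_on_cmx U phi;
  coords_SU : forall x, U x -> inSU (phi x);
  coords_inj : forall x u, U x -> coord_velocity phi x u = 0 -> u = 0;
  coords_surj : forall x Y, U x -> in_m Y ->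
    exists u, coord_velocity phi x u = Y
}.

Definition metric_in_coordinates (g : mat -> mat -> mat -> R) (N : nat)
    (phi : 'rV[R]_N -> mat) (x : 'rV[R]_N) : 'M[R]_N :=
  \matrix_(a, b) g (phi x) (coord_velocity phi x (delta_mx 0 a))
                           (coord_velocity phi x (delta_mx 0 b)).

Definition geodesic (g : mat -> mat -> mat -> R) (gamma : R -> set mat) :
    Prop :=
  forall t0 : R, exists (N : nat) (U : set 'rV[R]_N) (phi : 'rV[R]_N -> mat)
      (J : set R) (x : R -> 'rV[R]_N),
    [/\ local_coordinates U phi,
        open J /\ J t0,
        forall c, smooth_on J (fun t => x t 0 c),
        forall t, J t -> U (x t) /\ gamma t = coset (phi (x t)) &
        forall t, J t -> geodesic_eq_at (metric_in_coordinates g phi) x t].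

Definition equigeodesic_vector (X : mat) : Prop :=
  forall g, invariant_metric g ->
    geodesic g (fun t : R => coset (expmx (t%:C *: X))).

(* The coefficients lam i i are irrelevant on m. *)
Definition block_operator (lam : 'I_k -> 'I_k -> R) (A : mat) : mat :=
  \mxblock_(i < k, j < k) ((lam i j)%:C *: submxblock A i j).

(* These are exactly the operators Lambda on m such that
   g_o(Y, Z) = - killing (Lambda Y) Z for some invariant metric g. *)
Definition invariant_metric_operator (Lam : mat -> mat) : Prop :=
  exists lam : 'I_k -> 'I_k -> R,
    (forall i j, i != j -> 0 < lam i j /\ lam i j = lam j i) /\
    (forall A, in_m A -> Lam A = block_operator lam A).

End FlagManifold.

(* Main.v *)
Require Import Defs.
From mathcomp Require Import fingroup perm ring lra.

Set Implicit Arguments.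
Unset Strict Implicit.
Unset Printing Implicit Defensive.

Import Order.TTheory GRing.Theory Num.Theory.
Import numFieldNormedType.Exports.

Local Open Scope classical_set_scope.
Local Open Scope ring_scope.
Local Open Scope complex_scope.
Local Open Scope sesquilinear_scope.

(** Every invariant metric is, at every point, the form
    [beta Y Z = - Re tr (Lam Y *m Z)] on m for an operator [Lam] that multiplies
    each off-diagonal block by a positive weight ([invariant_metric_lam]), and all
    such forms are invariant metrics ([lam_form_invariant]).  The theorem therefore
    follows once it is known, for a single metric, that the curve exp(tX).o is a
    geodesic if and only if X commutes with Lam X.

    This is seen in any chart given by a lift phi to SU(n).  Let om_a be the
    components of phi^-1 dphi.  Give [Lam] weight zero on the diagonal blocks: then
    beta is defined on all matrices, ignores block-diagonal ones, and the Gram matrix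
    of the metric is beta(om_a, om_b).  The symmetry of second derivatives yields the
    structure equation of Maurer and Cartan ([maurer_cartan]), which turns the
    geodesic equation with lowered index l into
      beta(W', om_l) - beta(W, W om_l - om_l W) = 0,
    where W = phi^-1 phi' along the curve ([lowered_beta]).  For the curve exp(tX).o
    one has exp(tX) = phi(x(t)) h(t) with h(t) in K, so that W is the sum of
    hXh^-1 and of a block-diagonal matrix.  Invariance of beta under K makes all the
    terms containing the latter cancel ([beta_vertical_cancel]), and the left-hand
    side becomes -Re tr(h Q h^-1 om_l), where Q is the bracket of X and Lam X.  As the
    weights are symmetric, Q has zero diagonal blocks, hence lies in m.  As the om_l
    span m modulo k, the equations hold at a parameter t if and only if Q = 0
    ([geodesic_eq_lie]), a condition independent of t and of the chart.

    If X is equigeodesic, this equivalence is applied at t = 0 in any chart in which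
    the geodesic equation holds.  Conversely, a chart in which to verify the equation
    has to be produced: a product of exponentials gives one that contains the whole
    curve, as a straight line ([geodesic_chart]).  There the smoothness and the
    derivatives of the matrix exponential are needed, which are obtained from its
    power series. *)

(** * Smooth real functions *)

Section CkClosure.
Variables (R : realType) (V : normedModType R).
Implicit Types (A B : set V) (f g : V -> R).

Lemma Ck_onS m A f : Ck_on m.+1 A f -> Ck_on m A f.
Proof.
elim: m f => [f [df _] x Ax|m IHm f [df ddf]].
  exact/differentiable_continuous/df.
by split=> // v; apply: IHm; apply: ddf.
Qed.

Lemma Ck_on_sub m A B f : A `<=` B -> Ck_on m B f -> Ck_on m A f.
Proof.
move=> AB; elim: m f => [f cf x Ax|m IHm f [df ddf]]; first exact/cf/AB.
by split=> [x Ax|v]; [exact: (df _ (AB _ Ax))|apply: IHm; exact: ddf].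
Qed.

Lemma smooth_on_sub A B f : A `<=` B -> smooth_on B f -> smooth_on A f.
Proof. by move=> AB sf m; apply: Ck_on_sub AB (sf m). Qed.

Lemma smooth_onD1 A f v : smooth_on A f -> smooth_on A ('D_v f).
Proof. by move=> sf m; have [_ H] := sf m.+1; exact: H. Qed.

Lemma smooth_on_diff A f x : smooth_on A f -> A x -> differentiable f x.
Proof. by move=> sf Ax; have [H _] := sf 1%N; exact: H. Qed.

Lemma Ck_cst m A (c : R) : Ck_on m A (fun=> c).
Proof.
elim: m c => [c x _|m IHm c]; first exact: cst_continuous.
split=> [x _|v]; first exact: differentiable_cst.
by rewrite (_ : 'D_v _ = fun=> 0)//; apply/funext => x; exact: derive_cst.
Qed.

Lemma CkD m f g : Ck_on m setT f -> Ck_on m setT g ->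
  Ck_on m setT (fun x => f x + g x).
Proof.
elim: m f g => [f g cf cg x _|m IHm f g [df ddf] [dg ddg]].
  by apply: continuousD; [exact: (cf _ I)|exact: (cg _ I)].
split=> [x _|v]; first by apply: differentiableD; [exact: (df _ I)|exact: (dg _ I)].
rewrite (_ : 'D_v _ = fun x => 'D_v f x + 'D_v g x).
  by apply: IHm; [exact: ddf|exact: ddg].
apply/funext => x; apply: deriveD; apply: diff_derivable; [exact: (df _ I)|exact: (dg _ I)].
Qed.

Lemma CkM m f g : Ck_on m setT f -> Ck_on m setT g ->
  Ck_on m setT (fun x => f x * g x).
Proof.
elim: m f g => [f g cf cg x _|m IHm f g Cf Cg].
  by apply: continuousM; [exact: (cf _ I)|exact: (cg _ I)].
have [df ddf] := Cf; have [dg ddg] := Cg.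
split=> [x _|v]; first by apply: differentiableM; [exact: (df _ I)|exact: (dg _ I)].
rewrite (_ : 'D_v _ = fun x => f x * 'D_v g x + g x * 'D_v f x).
  by apply: CkD; apply: IHm; [exact: Ck_onS Cf|exact: ddg|exact: Ck_onS Cg|exact: ddf].
apply/funext => x; apply: deriveM; apply: diff_derivable; [exact: (df _ I)|exact: (dg _ I)].
Qed.

Lemma smoothD f g : smooth_on setT f -> smooth_on setT g ->
  smooth_on setT (fun x => f x + g x).
Proof. by move=> sf sg m; apply: CkD. Qed.

Lemma smoothM f g : smooth_on setT f -> smooth_on setT g ->
  smooth_on setT (fun x => f x * g x).
Proof. by move=> sf sg m; apply: CkM. Qed.

Lemma smooth_cst A c : smooth_on A (fun=> c : R).
Proof. by move=> m; apply: Ck_cst. Qed.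

Lemma smoothN f : smooth_on setT f -> smooth_on setT (fun x => - f x).
Proof.
move=> sf; rewrite (_ : (fun _ => _) = fun x => -1 * f x).
  by apply: smoothM => //; exact: smooth_cst.
by apply/funext => x; rewrite mulN1r.
Qed.

Lemma Ck_sum m I (r : seq I) (P : pred I) (F : I -> V -> R) :
  (forall i, P i -> Ck_on m setT (F i)) ->
  Ck_on m setT (fun x => \sum_(i <- r | P i) F i x).
Proof.
move=> sF; rewrite (_ : (fun _ => _) = \big[(fun f g x => f x + g x)/(fun=> 0)]_(i <- r | P i) F i).
  by apply: big_ind => //; [exact: Ck_cst|move=> f g; exact: CkD].
apply/funext => x; apply: (big_rec2 (fun a (f : V -> R) => a = f x)) => //.
by move=> i a f _ ->.
Qed.

Lemma smooth_sum I (r : seq I) (P : pred I) (F : I -> V -> R) :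
  (forall i, P i -> smooth_on setT (F i)) ->
  smooth_on setT (fun x => \sum_(i <- r | P i) F i x).
Proof. by move=> sF m; apply: Ck_sum => i Pi; exact: sF. Qed.

Lemma smooth_prod I (r : seq I) (P : pred I) (F : I -> V -> R) :
  (forall i, P i -> smooth_on setT (F i)) ->
  smooth_on setT (fun x => \prod_(i <- r | P i) F i x).
Proof.
move=> sF; rewrite (_ : (fun _ => _) = \big[(fun f g x => f x * g x)/(fun=> 1)]_(i <- r | P i) F i).
  by apply: big_ind => //; [exact: smooth_cst|move=> f g; exact: smoothM].
apply/funext => x; apply: (big_rec2 (fun a (f : V -> R) => a = f x)) => //.
by move=> i a f _ ->.
Qed.

Lemma smooth_det N (M : V -> 'M[R]_N) :
  (forall a b, smooth_on setT (fun x => M x a b)) -> smooth_on setT (fun x => \det (M x)).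
Proof.
move=> sM; apply: smooth_sum => s _; apply: smoothM; first exact: smooth_cst.
by apply: smooth_prod => i _; exact: sM.
Qed.

End CkClosure.

Section LinearForms.
Variables (R : realType) (V : normedModType R).

Lemma derive_comp_form (l : V -> R) (h : R -> R) (x v : V) :
  differentiable l x -> differentiable h (l x) ->
  'D_v (fun y => h (l y)) x = 'D_v l x * 'D_1 h (l x).
Proof.
move=> dl dh; rewrite deriveE; last exact: (@differentiable_comp _ _ _ _ l h).
rewrite (@diff_comp _ _ _ _ l h)//= -(deriveE _ dl).
by rewrite -[X in 'd _ _ X]mulr1 [LHS]linearZ -(deriveE _ dh).
Qed.

(** As [l] is linear, differentiating [h \o l] along [v] only multiplies
    [h^`() \o l] by the constant [l v], so the induction on the order of
    differentiability closes without a general chain rule for higher derivatives. *)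
Lemma smooth_comp_form (l : V -> R) (h : R -> R) :
  (forall x, differentiable l x) -> (forall x v, 'D_v l x = l v) ->
  smooth_on setT h -> smooth_on setT (fun x => h (l x)).
Proof.
move=> dl Dl sh m; elim: m h sh => [h sh x _|m IHm h sh].
  apply: (@continuous_comp _ _ _ l h); last exact: (sh 0%N _ I).
  exact: differentiable_continuous.
have dh (t : R) : differentiable h t by exact: (smooth_on_diff sh I).
split=> [x _|v]; first exact: (@differentiable_comp _ _ _ _ l h).
rewrite (_ : 'D_v _ = fun x => l v * 'D_1 h (l x)).
  apply: CkM; first exact: Ck_cst.
  by apply: (IHm ('D_1 h)); exact: smooth_onD1.
by apply/funext => x; rewrite derive_comp_form// Dl.
Qed.

End LinearForms.

Lemma smooth_id (R : realType) : smooth_on setT (fun t : R => t).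
Proof.
case=> [|m]; first by move=> t _; exact: cvg_id.
split=> [t _|v]; first exact/derivable1_diffP/derivable_id.
rewrite (_ : 'D_v _ = fun=> v); first exact: Ck_cst.
by apply/funext => t; exact: derive_id.
Qed.

(** * Symmetry of second derivatives *)

Section Schwarz.
Variables (R : realType) (V : normedModType R).
Implicit Types (A : set V) (f : V -> R).

Lemma is_derive_line f (p u : V) (s d : R) :
  is_derive (p + s *: u) u f d -> is_derive s 1 (fun r : R => f (p + r *: u)) d.
Proof.
have E : (fun h : R => h^-1 *: (((fun r : R => f (p + r *: u)) \o shift s) (h *: 1) - f (p + s *: u)))
   = (fun h : R => h^-1 *: ((f \o shift (p + s *: u)) (h *: u) - f (p + s *: u))).
  apply/funext => h /=; congr (_ *: (f _ - _)).
  by rewrite [h *: 1]mulr1 scalerDl addrCA.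
by case=> [fl <-]; split; [rewrite /derivable E|rewrite /derive E].
Qed.

Lemma MVT_line f (p u : V) (s : R) : 0 < s ->
  (forall r, 0 <= r <= s -> differentiable f (p + r *: u)) ->
  exists2 r, 0 <= r <= s & f (p + s *: u) - f p = s * 'D_u f (p + r *: u).
Proof.
move=> s0 df.
have dl r : 0 <= r <= s ->
    is_derive r 1 (fun r : R => f (p + r *: u)) ('D_u f (p + r *: u)).
  by move=> rs; apply: is_derive_line; apply: derivableP; apply: diff_derivable; exact: df.
have [r| |r] := @MVT R (fun r : R => f (p + r *: u)) (fun r => 'D_u f (p + r *: u)) 0 s s0.
- by rewrite in_itv/= => /andP[r0 rs]; apply: dl; rewrite !ltW.
- apply: continuous_in_subspaceT => r /set_mem; rewrite /= in_itv/= => rs.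
  apply: differentiable_continuous; apply/derivable1_diffP.
  exact: (@ex_derive _ _ _ _ _ _ _ (dl _ rs)).
- rewrite in_itv/= => /andP[r0 rs]; rewrite scale0r addr0 subr0 mulrC => H.
  by exists r; rewrite ?ltW.
Qed.

Lemma derive_translate f (x u w : V) :
  'D_u (fun y => f (y + w)) x = 'D_u f (x + w).
Proof.
rewrite /derive.
suff -> : (fun h : R => h^-1 *: (((fun y => f (y + w)) \o shift x) (h *: u) - f (x + w)))
   = (fun h : R => h^-1 *: ((f \o shift (x + w)) (h *: u) - f (x + w))) by [].
by apply/funext => h /=; rewrite addrA.
Qed.

(** The mean value theorem is applied twice: along [u] to the increment of [f] in
    the direction [v], then along [v] to ['D_u f]. *)
Lemma second_difference A f (x u v : V) (s : R) : 0 < s -> Ck_on 2 A f ->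
  (forall a b, 0 <= a <= s -> 0 <= b <= s -> A (x + a *: u + b *: v)) ->
  exists a b, [/\ 0 <= a <= s, 0 <= b <= s &
    f (x + s *: u + s *: v) - f (x + s *: u) - (f (x + s *: v) - f x)
      = s * (s * 'D_v ('D_u f) (x + a *: u + b *: v))].
Proof.
move=> s0 [df ddf] Axy.
have s00 : 0 <= s <= s by rewrite lexx ltW.
have z0 : 0 <= (0 : R) <= s by rewrite lexx ltW.
pose g := fun y => f (y + s *: v) - f y.
have dfs y : differentiable f (y + s *: v) -> differentiable (fun y => f (y + s *: v)) y.
  move=> h; apply: (@differentiable_comp _ _ _ _ (fun y => y + s *: v) f) => //.
have dg r : 0 <= r <= s -> differentiable g (x + r *: u).
  move=> rs; apply: differentiableB.
    by apply: dfs; apply: df; exact: Axy.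
  by apply: df; rewrite -[X in A X]addr0 -(scale0r v); exact: Axy.
have [a as_ E] := MVT_line s0 dg.
have [b bs E2] : exists2 b, 0 <= b <= s & 'D_u f (x + a *: u + s *: v) - 'D_u f (x + a *: u) = s * 'D_v ('D_u f) (x + a *: u + b *: v).
  apply: (@MVT_line ('D_u f) (x + a *: u) v s s0) => r rs; have [+ _] := ddf u; apply; exact: Axy.
exists a, b; split=> //; rewrite -E2.
transitivity (s * 'D_u g (x + a *: u)); first exact: E.
congr (_ * _).
have dfa : differentiable f (x + a *: u) by apply: df; rewrite -[X in A X]addr0 -(scale0r v); exact: Axy.
have dfb : differentiable (fun y => f (y + s *: v)) (x + a *: u) by apply: dfs; apply: df; exact: Axy.
have -> : g = (fun y => f (y + s *: v)) - f by [].
rewrite deriveB; [|exact: diff_derivable..].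
by rewrite derive_translate.
Qed.

(** The second difference of [f] on the parallelogram of sides [s *: u] and
    [s *: v] does not distinguish [u] from [v].  Read in either order it is [s ^+ 2]
    times a mixed derivative at a point of the parallelogram, so by continuity both
    mixed derivatives at [x] are within every [e] of each other. *)
Lemma derive_swap A f (x u v : V) : open A -> A x -> Ck_on 2 A f ->
  'D_v ('D_u f) x = 'D_u ('D_v f) x.
Proof.
move=> oA Ax cf.
have [_ ddf] := cf.
have cuv : {for x, continuous ('D_v ('D_u f))} by have [_ h] := ddf u; exact: h.
have cvu : {for x, continuous ('D_u ('D_v f))} by have [_ h] := ddf v; exact: h.
apply/eqP; rewrite -subr_eq0 -normr_eq0 eq_le normr_ge0 andbT.
apply/ler_addgt0Pl => e e0; rewrite addr0.
have e20 : 0 < e / 2 by rewrite divr_gt0.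
have h1 : nbhs x A by exact: open_nbhs_nbhs.
have h2 := (cvgrPdist_lt _ _).1 cuv _ e20; have {}h2 := h2 (nbhs_filter x).
have h3 := (cvgrPdist_lt _ _).1 cvu _ e20; have {}h3 := h3 (nbhs_filter x).
have [d /= d0 Hd0] := (nbhs_ballP _ _).1 (filterI h1 (filterI h2 h3)).
have Hd y : ball x d y -> [/\ A y, `|'D_v ('D_u f) x - 'D_v ('D_u f) y| < e / 2 & `|'D_u ('D_v f) x - 'D_u ('D_v f) y| < e / 2].
  move/Hd0 => H; have H1 := H.1; have H2 := H.2.1; have H3 := H.2.2.
  by split; [exact: H1|exact: H2|exact: H3].
(* a side so short that the parallelogram at x stays in the ball of radius d *)
pose s := d / 2 / (1 + `|u| + `|v|).
have k0 : 0 < 1 + `|u| + `|v| by rewrite -addrA ltr_pwDl.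
have s0 : 0 < s by rewrite !divr_gt0.
have inb a b : 0 <= a <= s -> 0 <= b <= s -> ball x d (x + a *: u + b *: v).
  move=> /andP[a0 as_] /andP[b0 bs].
  rewrite -ball_normE /ball_/= !opprD !addrA subrr sub0r -opprD normrN.
  apply: (le_lt_trans (ler_normD _ _)); rewrite !normrZ !ger0_norm//.
  apply: (@le_lt_trans _ _ (s * (1 + `|u| + `|v|))); last first.
    by rewrite /s divfK ?gt_eqF// ltr_pdivrMr// ltr_pMr// ltr1n.
  rewrite -addrA mulrDr mulrDr mulr1; apply: ler_wpDl; first exact: ltW.
  by apply: lerD; apply: ler_wpM2r.
have inb' a b : 0 <= a <= s -> 0 <= b <= s -> ball x d (x + a *: v + b *: u).
  by move=> ha hb; rewrite addrAC; exact: inb.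
have [a [b [as_ bs E1]]] := second_difference s0 cf (fun a b ha hb => (let: And3 h _ _ := Hd _ (inb a b ha hb) in h)).
have [c [c' [cs cs' E2]]] := second_difference s0 cf (fun a b ha hb => (let: And3 h _ _ := Hd _ (inb' a b ha hb) in h)).
have {E1}E : 'D_v ('D_u f) (x + a *: u + b *: v) = 'D_u ('D_v f) (x + c *: v + c' *: u).
  apply: (mulfI (lt0r_neq0 s0)); apply: (mulfI (lt0r_neq0 s0)).
  have swapB (p q r t : R) : p - q - (r - t) = p - r - (q - t) by ring.
  have E12 := swapB (f (x + s *: u + s *: v)) (f (x + s *: u)) (f (x + s *: v)) (f x).
  rewrite {2}(addrAC x (s *: u)) in E12.
  exact (etrans (esym E1) (etrans E12 E2)).
have [_ H1 _] := Hd _ (inb _ _ as_ bs); have [_ _ H2] := Hd _ (inb' _ _ cs cs').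
rewrite -E in H2; rewrite (splitr e).
rewrite -(subrKA ('D_v ('D_u f) (x + a *: u + b *: v))).
apply: (le_trans (ler_normD _ _)); apply: lerD; apply: ltW; first exact: H1.
rewrite distrC; exact: H2.
Qed.

End Schwarz.

(** * Derivatives of complex matrices *)

Section ComplexParts.
Variable R : realType.
Implicit Types x y : R[i].

Lemma cReD x y : complex.Re (x + y) = complex.Re x + complex.Re y.
Proof. by case: x y => [a b] [c d]. Qed.
Lemma cImD x y : complex.Im (x + y) = complex.Im x + complex.Im y.
Proof. by case: x y => [a b] [c d]. Qed.
Lemma cReN x : complex.Re (- x) = - complex.Re x. Proof. by case: x. Qed.
Lemma cReM x y : complex.Re (x * y) =
  complex.Re x * complex.Re y - complex.Im x * complex.Im y.
Proof. by case: x y => [a b] [c d]. Qed.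
Lemma cImM x y : complex.Im (x * y) =
  complex.Re x * complex.Im y + complex.Im x * complex.Re y.
Proof. by case: x y => [a b] [c d]. Qed.
Lemma cReJ x : complex.Re (conjc x) = complex.Re x. Proof. by case: x. Qed.
Lemma cImJ x : complex.Im (conjc x) = - complex.Im x. Proof. by case: x. Qed.
Lemma cRe_sum I (r : seq I) (P : pred I) (F : I -> R[i]) :
  complex.Re (\sum_(i <- r | P i) F i) = \sum_(i <- r | P i) complex.Re (F i).
Proof. by elim/big_rec2: _ => // i y1 y2 _ <-; rewrite cReD. Qed.
Lemma cIm_sum I (r : seq I) (P : pred I) (F : I -> R[i]) :
  complex.Im (\sum_(i <- r | P i) F i) = \sum_(i <- r | P i) complex.Im (F i).
Proof. by elim/big_rec2: _ => // i y1 y2 _ <-; rewrite cImD. Qed.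
Lemma complex_ext x y : complex.Re x = complex.Re y -> complex.Im x = complex.Im y -> x = y.
Proof. by case: x y => [a b] [c d] /= -> ->. Qed.
End ComplexParts.

Section MatrixDerivative.
Variables (R : realType) (V : normedModType R).
Local Notation C := R[i].

(** The point varies in a real space, so a complex value is differentiated through
    its real and imaginary parts. *)
Definition is_cderive (x v : V) (f : V -> C) (d : C) : Prop :=
  is_derive x v (fun y => complex.Re (f y)) (complex.Re d) /\
  is_derive x v (fun y => complex.Im (f y)) (complex.Im d).

Definition is_mxderive m n (x v : V) (F : V -> 'M[C]_(m, n)) (D : 'M[C]_(m, n)) :=
  forall a b, is_cderive x v (fun y => F y a b) (D a b).

Lemma is_derive_ext (f g : V -> R) x v d d' : f =1 g -> d = d' ->
  is_derive x v f d -> is_derive x v g d'.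
Proof. by move=> /funext -> ->. Qed.

Lemma is_cderive_ext (f g : V -> C) x v d d' : f =1 g -> d = d' ->
  is_cderive x v f d -> is_cderive x v g d'.
Proof. by move=> /funext -> ->. Qed.

Lemma is_mxderive_ext m n (F G : V -> 'M[C]_(m, n)) x v D D' : F =1 G -> D = D' ->
  is_mxderive x v F D -> is_mxderive x v G D'.
Proof. by move=> /funext -> ->. Qed.

Lemma is_cderive_near (f g : V -> C) x v d : (\forall y \near x, f y = g y) ->
  is_cderive x v f d -> is_cderive x v g d.
Proof.
move=> fg [h1 h2]; split; [apply: near_eq_is_derive h1|apply: near_eq_is_derive h2];
  by apply: filterS fg => y ->.
Qed.

Lemma is_mxderive_near m n (F G : V -> 'M[C]_(m, n)) x v D :
  (\forall y \near x, F y = G y) -> is_mxderive x v F D -> is_mxderive x v G D.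
Proof.
move=> FG h a b; apply: is_cderive_near (h a b).
by apply: filterS FG => y ->.
Qed.

Lemma is_cderive_uniq (f : V -> C) x v d d' :
  is_cderive x v f d -> is_cderive x v f d' -> d = d'.
Proof.
move=> [h1 h2] [h3 h4]; apply: complex_ext.
  by rewrite -(@derive_val _ _ _ _ _ _ _ h1) -(@derive_val _ _ _ _ _ _ _ h3).
by rewrite -(@derive_val _ _ _ _ _ _ _ h2) -(@derive_val _ _ _ _ _ _ _ h4).
Qed.

Lemma is_mxderive_uniq m n (F : V -> 'M[C]_(m, n)) x v D D' :
  is_mxderive x v F D -> is_mxderive x v F D' -> D = D'.
Proof. by move=> h h'; apply/matrixP => a b; apply: is_cderive_uniq (h a b) (h' a b). Qed.

Lemma is_cderive_cst (c : C) x v : is_cderive x v (fun=> c) 0.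
Proof. by split; exact: is_derive_cst. Qed.

Lemma is_mxderive_cst m n (A : 'M[C]_(m, n)) x v : is_mxderive x v (fun=> A) 0.
Proof. by move=> a b; rewrite mxE; exact: is_cderive_cst. Qed.

Lemma is_cderiveD (f g : V -> C) x v d e :
  is_cderive x v f d -> is_cderive x v g e -> is_cderive x v (fun y => f y + g y) (d + e).
Proof.
move=> [h1 h2] [h3 h4]; split.
  by apply: is_derive_ext (is_deriveD h1 h3) => [y|]; rewrite ?cReD.
by apply: is_derive_ext (is_deriveD h2 h4) => [y|]; rewrite ?cImD.
Qed.

Lemma is_cderive_conj (f : V -> C) x v d :
  is_cderive x v f d -> is_cderive x v (fun y => conjc (f y)) (conjc d).
Proof.
move=> [h1 h2]; split.
  by apply: is_derive_ext h1 => [y|]; rewrite ?cReJ.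
by apply: is_derive_ext (is_deriveN h2) => [y|]; rewrite ?cImJ.
Qed.

Lemma is_cderiveM (f g : V -> C) x v d e :
  is_cderive x v f d -> is_cderive x v g e ->
  is_cderive x v (fun y => f y * g y) (d * g x + f x * e).
Proof.
move=> [h1 h2] [h3 h4]; split.
  apply: is_derive_ext (is_deriveB (is_deriveM h1 h3) (is_deriveM h2 h4)) => [y|].
    by rewrite cReM.
  by rewrite cReD !cReM /GRing.scale/=; ring.
apply: is_derive_ext (is_deriveD (is_deriveM h1 h4) (is_deriveM h2 h3)) => [y|].
  by rewrite cImM.
by rewrite cImD !cImM /GRing.scale/=; ring.
Qed.

Lemma is_cderive_sum I (r : seq I) (P : pred I) (F : I -> V -> C) (D : I -> C) x v :
  (forall i, P i -> is_cderive x v (F i) (D i)) ->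
  is_cderive x v (fun y => \sum_(i <- r | P i) F i y) (\sum_(i <- r | P i) D i).
Proof.
move=> h; elim: r => [|i r IH].
  by rewrite big_nil; apply: is_cderive_ext (is_cderive_cst 0 x v) => [y|//]; rewrite big_nil.
rewrite big_cons; case: ifP => Pi.
  by apply: is_cderive_ext (is_cderiveD (h i Pi) IH) => [y|//]; rewrite big_cons Pi.
by apply: is_cderive_ext IH => [y|//]; rewrite big_cons Pi.
Qed.

Lemma is_mxderive_adj m n (F : V -> 'M[C]_(m, n)) x v D :
  is_mxderive x v F D -> is_mxderive x v (fun y => (F y)^t*) (D^t*).
Proof.
by move=> h a b; apply: is_cderive_ext (is_cderive_conj (h b a)) => [y|];
  rewrite !mxE.
Qed.

Lemma is_mxderiveM m n p (F : V -> 'M[C]_(m, n)) (G : V -> 'M[C]_(n, p)) x v D E :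
  is_mxderive x v F D -> is_mxderive x v G E ->
  is_mxderive x v (fun y => F y *m G y) (D *m G x + F x *m E).
Proof.
move=> h1 h2 a b.
apply: is_cderive_ext
  (is_cderive_sum (index_enum _) (P := xpredT)
    (fun i _ => is_cderiveM (h1 a i) (h2 i b))) => [y|]; rewrite !mxE//.
by rewrite -big_split.
Qed.

Lemma is_mxderive_trace n (F : V -> 'M[C]_n) x v D :
  is_mxderive x v F D -> is_cderive x v (fun y => \tr (F y)) (\tr D).
Proof. by move=> h; apply: is_cderive_sum. Qed.

Lemma is_mxderive_sum m n I (r : seq I) (P : pred I) (F : I -> V -> 'M[C]_(m, n))
    (D : I -> 'M[C]_(m, n)) x v :
  (forall i, P i -> is_mxderive x v (F i) (D i)) ->
  is_mxderive x v (fun y => \sum_(i <- r | P i) F i y) (\sum_(i <- r | P i) D i).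
Proof.
move=> h a b; apply: is_cderive_ext (is_cderive_sum r (fun i Pi => h i Pi a b)) => [y|];
  by rewrite summxE.
Qed.

Lemma is_mxderiveZ m n (f : V -> R) (F : V -> 'M[C]_(m, n)) x v d D :
  is_derive x v f d -> is_mxderive x v F D ->
  is_mxderive x v (fun y => (f y)%:C *: F y) (d%:C *: F x + (f x)%:C *: D).
Proof.
move=> h1 h2 a b.
have h : is_cderive x v (fun y => (f y)%:C) (d%:C) by split=> //; exact: is_derive_cst.
by apply: is_cderive_ext (is_cderiveM h (h2 a b)) => [y|]; rewrite !mxE.
Qed.

Lemma is_mxderive_cmx n (F : V -> 'M[C]_n) x v :
  (forall a b, derivable (fun y => complex.Re (F y a b)) x v /\
               derivable (fun y => complex.Im (F y a b)) x v) ->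
  is_mxderive x v F (derive_cmx F x v).
Proof.
by move=> h a b; have [h1 h2] := h a b; rewrite mxE; split=> /=; apply: derivableP.
Qed.

Lemma derive_cmxE n (F : V -> 'M[C]_n) x v D : is_mxderive x v F D ->
  derive_cmx F x v = D.
Proof.
move=> h; apply/matrixP => a b; rewrite mxE; have [h1 h2] := h a b.
by apply: complex_ext; rewrite /= ?(@derive_val _ _ _ _ _ _ _ h1) ?(@derive_val _ _ _ _ _ _ _ h2).
Qed.

Lemma smooth_cmx_diff n (A : set V) (F : V -> 'M[C]_n) x a b :
  smooth_on_cmx A F -> A x ->
  differentiable (fun y => complex.Re (F y a b)) x /\
  differentiable (fun y => complex.Im (F y a b)) x.
Proof.
move=> sF Ax; have [h1 h2] := sF a b.
by split; [exact: smooth_on_diff h1 Ax|exact: smooth_on_diff h2 Ax].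
Qed.

Lemma smooth_is_mxderive n (A : set V) (F : V -> 'M[C]_n) x v :
  smooth_on_cmx A F -> A x -> is_mxderive x v F (derive_cmx F x v).
Proof.
move=> sF Ax; apply: is_mxderive_cmx => a b.
have [h1 h2] := smooth_cmx_diff a b sF Ax.
by split; exact: diff_derivable.
Qed.

Lemma smooth_derive_cmx n (A : set V) (F : V -> 'M[C]_n) v :
  smooth_on_cmx A F -> smooth_on_cmx A (fun x => derive_cmx F x v).
Proof.
move=> sF a b; have [h1 h2] := sF a b.
split.
  rewrite (_ : (fun _ => _) = 'D_v (fun y => complex.Re (F y a b))).
    exact: smooth_onD1.
  by apply/funext => x; rewrite mxE.
rewrite (_ : (fun _ => _) = 'D_v (fun y => complex.Im (F y a b))).
  exact: smooth_onD1.
by apply/funext => x; rewrite mxE.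
Qed.

Lemma derive_cmx_swap n (A : set V) (F : V -> 'M[C]_n) x u v :
  open A -> A x -> smooth_on_cmx A F ->
  derive_cmx (fun y => derive_cmx F y u) x v = derive_cmx (fun y => derive_cmx F y v) x u.
Proof.
move=> oA Ax sF; apply/matrixP => a b; have [h1 h2] := sF a b; rewrite [LHS]mxE [RHS]mxE.
have E1 w : (fun y => complex.Re (derive_cmx F y w a b)) = 'D_w (fun y => complex.Re (F y a b)).
  by apply/funext => y; rewrite mxE.
have E2 w : (fun y => complex.Im (derive_cmx F y w a b)) = 'D_w (fun y => complex.Im (F y a b)).
  by apply/funext => y; rewrite mxE.
have H1 := derive_swap u v oA Ax (h1 2%N).
have H2 := derive_swap u v oA Ax (h2 2%N).
rewrite (E1 u) (E1 v) (E2 u) (E2 v).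
exact (f_equal2 (@Complex R) H1 H2).
Qed.

Lemma smooth_mxM n (F G : V -> 'M[C]_n) :
  smooth_on_cmx setT F -> smooth_on_cmx setT G ->
  smooth_on_cmx setT (fun x => F x *m G x).
Proof.
move=> sF sG a b; split.
  rewrite (_ : (fun _ => _) = fun x => \sum_c (complex.Re (F x a c) * complex.Re (G x c b)
     + - (complex.Im (F x a c) * complex.Im (G x c b)))).
    apply: smooth_sum => c _; apply: smoothD; [|apply: smoothN]; apply: smoothM;
      by [apply: (sF a c).1|apply: (sG c b).1|apply: (sF a c).2|apply: (sG c b).2].
  by apply/funext => x; rewrite mxE cRe_sum; apply: eq_bigr => c _; rewrite cReM.
rewrite (_ : (fun _ => _) = fun x => \sum_c (complex.Re (F x a c) * complex.Im (G x c b)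
     + (complex.Im (F x a c) * complex.Re (G x c b)))).
  apply: smooth_sum => c _; apply: smoothD; apply: smoothM;
    by [apply: (sF a c).1|apply: (sG c b).1|apply: (sF a c).2|apply: (sG c b).2].
by apply/funext => x; rewrite mxE cIm_sum; apply: eq_bigr => c _; rewrite cImM.
Qed.

Lemma smooth_mx_cst n (A : set V) (M : 'M[C]_n) : smooth_on_cmx A (fun=> M).
Proof. by move=> a b; split; exact: smooth_cst. Qed.

Lemma smooth_mx_adj n (F : V -> 'M[C]_n) :
  smooth_on_cmx setT F -> smooth_on_cmx setT (fun x => (F x)^t*).
Proof.
move=> sF a b; have [h1 h2] := sF b a; split.
  by rewrite (_ : (fun _ => _) = fun x => complex.Re (F x b a))//;
    apply/funext => x; rewrite !mxE cReJ.
rewrite (_ : (fun _ => _) = fun x => - complex.Im (F x b a)); first exact: smoothN.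
by apply/funext => x; rewrite !mxE cImJ.
Qed.

End MatrixDerivative.

Section Chain.
Variables (R : realType) (N : nat).
Local Notation C := R[i].

Lemma derive_dir (f : 'rV[R]_N -> R) (x v : 'rV[R]_N) : differentiable f x ->
  'D_v f x = \sum_a v 0 a * 'D_(delta_mx 0 a) f x.
Proof.
move=> df; rewrite deriveE// {1}(row_sum_delta v) linear_sum.
by apply: eq_bigr => a _; rewrite linearZ deriveE.
Qed.

Lemma derive_cmx_dir n (F : 'rV[R]_N -> 'M[C]_n) x v :
  (forall a b, differentiable (fun y => complex.Re (F y a b)) x /\
               differentiable (fun y => complex.Im (F y a b)) x) ->
  derive_cmx F x v = \sum_a (v 0 a)%:C *: derive_cmx F x (delta_mx 0 a).
Proof.
move=> h; apply/matrixP => a b; have [h1 h2] := h a b.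
rewrite summxE mxE; apply: complex_ext.
  by rewrite cRe_sum /= derive_dir//; apply: eq_bigr => c _; rewrite !mxE cReM/= mul0r subr0.
by rewrite cIm_sum /= derive_dir//; apply: eq_bigr => c _; rewrite !mxE cImM/= mul0r addr0.
Qed.

Lemma derivable_curve (x : R -> 'rV[R]_N) t :
  (forall c, derivable (fun s => x s 0 c) t 1) -> derivable x t 1.
Proof. by move=> h; apply/derivable_mxP => i j; rewrite ord1. Qed.

(** The chain rule along a curve, in coordinates: the differential of [f] is
    expanded on the coordinate directions. *)
Lemma is_derive_curve (f : 'rV[R]_N -> R) (x : R -> 'rV[R]_N) t :
  differentiable f (x t) -> (forall c, derivable (fun s => x s 0 c) t 1) ->
  is_derive t 1 (fun s => f (x s)) (\sum_a derive1 (fun s => x s 0 a) t * 'D_(delta_mx 0 a) f (x t)).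
Proof.
move=> df dx.
have dxt : differentiable x t by apply/derivable1_diffP; exact: derivable_curve.
have dfx : differentiable (fun s => f (x s)) t by exact: differentiable_comp.
suff E : 'D_1 (fun s => f (x s)) t = \sum_a derive1 (fun s => x s 0 a) t * 'D_(delta_mx 0 a) f (x t).
  by rewrite -E; apply: derivableP; apply/derivable1_diffP.
rewrite deriveE// diff_comp//= -deriveE//.
rewrite -deriveE// derive_dir//; apply: eq_bigr => a _; congr (_ * _).
by rewrite derive_mx ?mxE ?derive1E//; exact: derivable_curve.
Qed.

Lemma is_mxderive_curve n (F : 'rV[R]_N -> 'M[C]_n) (x : R -> 'rV[R]_N) t :
  (forall a b, differentiable (fun y => complex.Re (F y a b)) (x t) /\
               differentiable (fun y => complex.Im (F y a b)) (x t)) ->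
  (forall c, derivable (fun s => x s 0 c) t 1) ->
  is_mxderive t 1 (fun s => F (x s))
    (\sum_a (derive1 (fun s => x s 0 a) t)%:C *: derive_cmx F (x t) (delta_mx 0 a)).
Proof.
move=> h dx a b; have [h1 h2] := h a b; split.
  apply: is_derive_ext (is_derive_curve h1 dx) => //.
  by rewrite summxE cRe_sum; apply: eq_bigr => c _; rewrite !mxE cReM/= mul0r subr0.
apply: is_derive_ext (is_derive_curve h2 dx) => //.
by rewrite summxE cIm_sum; apply: eq_bigr => c _; rewrite !mxE cImM/= mul0r addr0.
Qed.

End Chain.

(** * The matrix exponential *)

Section ExpCoefficients.
Variable R : realType.

(** Domination by [M] times the exponential series at [r * `|t|]. *)
Lemma exp_type_cvg (a : R^nat) (M r : R) (t : R) :
  0 <= M -> 0 <= r -> (forall l, `|a l| <= M * r ^+ l) ->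
  cvgn (pseries (fun l => (l`!%:R)^-1 * a l) t).
Proof.
move=> M0 r0 ar; apply: normed_cvg.
apply: (@series_le_cvg _ _ (fun l => M * exp_coeff (r * `|t|) l)) => [l|l|l|].
- exact: normr_ge0.
- by apply: mulr_ge0 => //; apply: exp_coeff_ge0; apply: mulr_ge0.
- rewrite /exp_coeff/= !normrM normrX exprMn normfV [`|_%:R|]ger0_norm//.
  rewrite -mulrA mulrC !mulrA; apply: ler_wpM2r; first by rewrite invr_ge0.
  exact: (ler_wpM2r (exprn_ge0 l (normr_ge0 t)) (ar l)).
- by apply: is_cvg_seriesZ; exact: is_cvg_series_exp_coeff.
Qed.

Lemma pseries_diffs_fact (a : R^nat) :
  pseries_diffs (fun l => (l`!%:R)^-1 * a l) = (fun l => (l`!%:R)^-1 * a l.+1).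
Proof.
apply/funext => l; rewrite /pseries_diffs factS natrM invfM mulrA mulrA.
by rewrite mulfV ?mul1r// pnatr_eq0.
Qed.

(** Termwise differentiation shifts the coefficients, and the growth bound is
    stable under shifts up to replacing [M] by [M * r], so that all the derived series
    converge. *)
Lemma exp_type_is_derive (a : R^nat) (M r : R) (t : R) :
  0 <= M -> 0 <= r -> (forall l, `|a l| <= M * r ^+ l) ->
  is_derive t (1 : R) (fun t => limn (pseries (fun l => (l`!%:R)^-1 * a l) t))
    (limn (pseries (fun l => (l`!%:R)^-1 * a l.+1) t)).
Proof.
move=> M0 r0 ar.
have ar1 l : `|a l.+1| <= (M * r) * r ^+ l by rewrite -mulrA -exprS.
have ar2 l : `|a l.+2| <= (M * r * r) * r ^+ l by rewrite -!mulrA -!exprS.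
rewrite -pseries_diffs_fact; apply: (@pseries_snd_diffs _ _ (`|t| + 1)).
- exact: exp_type_cvg ar.
- by rewrite pseries_diffs_fact; apply: exp_type_cvg ar1 => //; exact: mulr_ge0.
- rewrite !pseries_diffs_fact; apply: exp_type_cvg ar2 => //.
  by rewrite !mulr_ge0.
- by rewrite [ltRHS]ger0_norm ?addr_ge0// ltrDl.
Qed.

End ExpCoefficients.

Section CvgMx.
Variable R : realType.
Local Notation C := R[i].

Definition cvg_mx m n (S : nat -> 'M[C]_(m, n)) (L : 'M[C]_(m, n)) : Prop :=
  forall a b, (fun k => complex.Re (S k a b)) @ \oo --> complex.Re (L a b) /\
              (fun k => complex.Im (S k a b)) @ \oo --> complex.Im (L a b).

Lemma cvg_bigsum (I : finType) (u : I -> R^nat) (l : I -> R) :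
  (forall i, u i @ \oo --> l i) -> (fun k => \sum_i u i k) @ \oo --> \sum_i l i.
Proof.
move=> ul; elim: (index_enum I) => [|i s IH].
  by rewrite big_nil; under eq_fun do rewrite big_nil; exact: cvg_cst.
by rewrite big_cons; under eq_fun do rewrite big_cons; exact: cvgD.
Qed.

Lemma cvg_mx_mull m n p (X : 'M[C]_(m, n)) (S : nat -> 'M[C]_(n, p)) L :
  cvg_mx S L -> cvg_mx (fun k => X *m S k) (X *m L).
Proof.
move=> SL a b; split.
  rewrite (_ : (fun _ => _) = fun k => \sum_i (complex.Re (X a i) * complex.Re (S k i b)
      - complex.Im (X a i) * complex.Im (S k i b))); last first.
    by apply/funext => k; rewrite mxE cRe_sum; apply: eq_bigr => i _; rewrite cReM.
  rewrite mxE cRe_sum.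
  apply: (@cvg_bigsum _ (fun i k => complex.Re (X a i) * complex.Re (S k i b)
      - complex.Im (X a i) * complex.Im (S k i b))) => i; rewrite cReM.
  have [h1 h2] := SL i b; apply: cvgB; apply: cvgM => //; exact: cvg_cst.
rewrite (_ : (fun _ => _) = fun k => \sum_i (complex.Re (X a i) * complex.Im (S k i b)
    + complex.Im (X a i) * complex.Re (S k i b))); last first.
  by apply/funext => k; rewrite mxE cIm_sum; apply: eq_bigr => i _; rewrite cImM.
rewrite mxE cIm_sum.
apply: (@cvg_bigsum _ (fun i k => complex.Re (X a i) * complex.Im (S k i b)
    + complex.Im (X a i) * complex.Re (S k i b))) => i; rewrite cImM.
have [h1 h2] := SL i b; apply: cvgD; apply: cvgM => //; exact: cvg_cst.
Qed.

Lemma cvg_mx_tr m n (S : nat -> 'M[C]_(m, n)) L :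
  cvg_mx S L -> cvg_mx (fun k => (S k)^T) L^T.
Proof.
move=> SL a b; have [h1 h2] := SL b a; rewrite mxE; split.
  by rewrite (_ : (fun _ => _) = (fun k => complex.Re (S k b a)))//; apply/funext => k; rewrite mxE.
by rewrite (_ : (fun _ => _) = (fun k => complex.Im (S k b a)))//; apply/funext => k; rewrite mxE.
Qed.

Lemma cvg_mx_mulr m n p (X : 'M[C]_(n, p)) (S : nat -> 'M[C]_(m, n)) L :
  cvg_mx S L -> cvg_mx (fun k => S k *m X) (L *m X).
Proof.
move=> /cvg_mx_tr/(cvg_mx_mull X^T)/cvg_mx_tr; rewrite trmx_mul !trmxK.
by rewrite (_ : (fun _ => _) = (fun k => S k *m X))//; apply/funext => k; rewrite trmx_mul !trmxK.
Qed.

Lemma cvg_mx_uniq m n (S : nat -> 'M[C]_(m, n)) L L' : cvg_mx S L -> cvg_mx S L' -> L = L'.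
Proof.
move=> h h'; apply/matrixP => a b; have [h1 h2] := h a b; have [h3 h4] := h' a b.
by apply: complex_ext; [apply: cvg_unique h1 h3|apply: cvg_unique h2 h4].
Qed.

End CvgMx.

Section Expmx.
Variables (R : realType) (n : nat).
Local Notation C := R[i].
Implicit Types X : 'M[C]_n.

(** The sum [r] of the absolute values of all entries of [X] is a submultiplicative
    bound: each entry of [X ^+ l.+1] is a sum over one row of [X] of products with
    entries of [X ^+ l]. *)
Lemma expmx_entry_bound X : exists2 r : R, 0 <= r & forall l a b,
  `|complex.Re ((X ^+ l) a b)| <= r ^+ l /\ `|complex.Im ((X ^+ l) a b)| <= r ^+ l.
Proof.
pose rC : C := \sum_a \sum_b `|X a b|.
have rC0 : 0 <= rC by apply: sumr_ge0 => a _; apply: sumr_ge0 => b _; exact: normr_ge0.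
have rE : rC = (complex.Re rC)%:C by rewrite RRe_real// ger0_real.
exists (complex.Re rC); first by rewrite -lecR -rE.
have bnd l a b : `|(X ^+ l) a b| <= rC ^+ l.
  elim: l a b => [|l IH] a b.
    by rewrite !expr0 mxE; case: eqP => _; rewrite ?normr1 ?normr0 ?ler01.
  rewrite !exprS mxE; apply: (le_trans (ler_norm_sum _ _ _)).
  apply: (@le_trans _ _ (\sum_c `|X a c| * rC ^+ l)).
    by apply: ler_sum => c _; rewrite normrM; apply: ler_wpM2l.
  rewrite -mulr_suml; apply: ler_wpM2r; first exact: exprn_ge0.
  rewrite /rC [leRHS](bigD1 a)//= lerDl; apply: sumr_ge0 => c _; apply: sumr_ge0 => d _.
  exact: normr_ge0.
move=> l a b; have := bnd l a b; rewrite rE -rmorphXn/= => h.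
split; rewrite -lecR; first exact: le_trans (normc_ge_Re _) h.
(* the imaginary part is, up to sign, the real part after multiplication by i *)
apply: le_trans h; have := normc_ge_Re ((X ^+ l) a b * 'i%C).
rewrite ReiNIm normrN => /le_trans; apply; rewrite normrM.
have -> : `|'i%C| = 1 :> C by rewrite normc_def/= expr0n/= expr1n add0r sqrtr1.
by rewrite mulr1.
Qed.

Lemma exprmxZ (c : C) X l : (c *: X) ^+ l = c ^+ l *: X ^+ l.
Proof.
elim: l => [|l IH]; first by rewrite !expr0 scale1r.
by rewrite !exprS IH -[LHS]scalemxAl -[X in _ *: X]scalemxAr scalerA.
Qed.

Lemma expmx_partialE X (t : R) m a b :
  complex.Re (expmx_partial (t%:C *: X) m a b) =
    pseries (fun l => (l`!%:R)^-1 * complex.Re ((X ^+ l) a b)) t m /\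
  complex.Im (expmx_partial (t%:C *: X) m a b) =
    pseries (fun l => (l`!%:R)^-1 * complex.Im ((X ^+ l) a b)) t m.
Proof.
have E l : ((l`!%:R)^-1 *: (t%:C *: X) ^+ l) a b =
   ((l`!%:R)^-1 * t ^+ l)%:C * (X ^+ l) a b.
  rewrite exprmxZ !mxE rmorphM/= fmorphV/= rmorph_nat rmorphXn/= mulrA//.
rewrite /expmx_partial summxE cRe_sum cIm_sum /pseries /series/=.
by split; apply: eq_bigr => l _; rewrite E ?cReM ?cImM/= mul0r ?subr0 ?addr0 mulrAC.
Qed.

Lemma expmx_cvg X (t : R) : cvg_mx (expmx_partial (t%:C *: X)) (expmx (t%:C *: X)).
Proof.
have [r r0 bnd] := expmx_entry_bound X.
move=> a b; rewrite mxE /=; split.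
  under eq_fun do rewrite (expmx_partialE _ _ _ _ _).1.
  by apply: (@exp_type_cvg _ _ 1 r) => // l; rewrite mul1r; case: (bnd l a b).
under eq_fun do rewrite (expmx_partialE _ _ _ _ _).2.
by apply: (@exp_type_cvg _ _ 1 r) => // l; rewrite mul1r; case: (bnd l a b).
Qed.

Lemma expmx_partial_comm X (t : R) m :
  X *m expmx_partial (t%:C *: X) m = expmx_partial (t%:C *: X) m *m X.
Proof.
rewrite /expmx_partial mulmx_sumr mulmx_suml; apply: eq_bigr => l _.
by rewrite exprmxZ -!scalemxAr -!scalemxAl -[X *m _]exprS -[_ *m X]exprSr.
Qed.

Lemma expmx_comm X (t : R) : X *m expmx (t%:C *: X) = expmx (t%:C *: X) *m X.
Proof.
apply: cvg_mx_uniq (cvg_mx_mull X (expmx_cvg X t)) _.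
rewrite (_ : (fun k => _) = fun k => expmx_partial (t%:C *: X) k *m X).
  exact: cvg_mx_mulr (expmx_cvg X t).
by apply/funext => k; exact: expmx_partial_comm.
Qed.

(** Entrywise, [expmx (s *: X)] is a power series in [s] with coefficients of
    exponential type, so it may be differentiated termwise; multiplying a partial sum
    by [X] is exactly the shift of the coefficients. *)
Lemma expmx_is_derive X (t : R) :
  is_mxderive t 1 (fun s : R => expmx (s%:C *: X)) (X *m expmx (t%:C *: X)).
Proof.
have [r r0 bnd] := expmx_entry_bound X.
have XE l a b : ((l`!%:R)^-1 *: (t%:C *: X) ^+ l) a b =
   ((l`!%:R)^-1 * t ^+ l)%:C * (X ^+ l) a b.
  rewrite exprmxZ !mxE rmorphM/= fmorphV/= rmorph_nat rmorphXn/= mulrA//.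
have SE m a b : (X *m expmx_partial (t%:C *: X) m) a b =
    \sum_(0 <= l < m) ((l`!%:R)^-1 * t ^+ l)%:C * (X ^+ l.+1) a b.
  rewrite /expmx_partial mulmx_sumr summxE; apply: eq_bigr => l _.
  by rewrite exprmxZ -!scalemxAr -[X *m _]exprS mxE mxE mulrA rmorphM/= fmorphV/= rmorph_nat rmorphXn.
move=> a b; have [h1 h2] := cvg_mx_mull X (expmx_cvg X t) a b; split.
  apply: is_derive_ext (@exp_type_is_derive _ (fun l => complex.Re ((X ^+ l) a b)) 1 r t ler01 r0 _) => [s||l].
  - rewrite mxE/=; congr (limn _); apply/funext => m.
    by rewrite (expmx_partialE _ _ _ _ _).1.
  - apply: cvg_lim => //; apply: cvg_trans h1; rewrite (_ : pseries _ _ = (fun k => complex.Re ((X *m expmx_partial (t%:C *: X) k) a b)))//.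
    apply/funext => m; rewrite SE cRe_sum; apply: eq_bigr => l _.
    by rewrite cReM/= mul0r subr0 mulrAC.
  - by rewrite mul1r; case: (bnd l a b).
apply: is_derive_ext (@exp_type_is_derive _ (fun l => complex.Im ((X ^+ l) a b)) 1 r t ler01 r0 _) => [s||l].
- rewrite mxE/=; congr (limn _); apply/funext => m.
  by rewrite (expmx_partialE _ _ _ _ _).2.
- apply: cvg_lim => //; apply: cvg_trans h2; rewrite (_ : pseries _ _ = (fun k => complex.Im ((X *m expmx_partial (t%:C *: X) k) a b)))//.
  apply/funext => m; rewrite SE cIm_sum; apply: eq_bigr => l _.
  by rewrite cImM/= mul0r addr0 mulrAC.
- by rewrite mul1r; case: (bnd l a b).
Qed.

Lemma expmx0 : expmx (0 : 'M[C]_n) = 1%:M.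
Proof.
have := expmx_cvg (0 : 'M[C]_n) 0; rewrite scaler0 => /cvg_mx_uniq; apply.
suff E k : expmx_partial (0 : 'M[C]_n) k.+1 = 1%:M.
  move=> a b; split; rewrite -cvg_shiftS.
    by rewrite (_ : (fun _ => _) = cst (complex.Re ((1%:M : 'M[C]_n) a b))); [exact: cvg_cst|apply/funext => k; rewrite /= E].
  by rewrite (_ : (fun _ => _) = cst (complex.Im ((1%:M : 'M[C]_n) a b))); [exact: cvg_cst|apply/funext => k; rewrite /= E].
rewrite /expmx_partial big_nat_recl// expr0 fact0 invr1 scale1r big1_seq ?addr0// => l _.
by rewrite expr0n scaler0.
Qed.

Lemma is_mxderive0_cst (F : R -> 'M[C]_n) s t :
  (forall t, is_mxderive t (1 : R) F 0) -> F s = F t.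
Proof.
move=> dF; apply/matrixP => a b; apply: complex_ext.
  by apply: (@is_derive_0_is_cst _ (fun t => complex.Re (F t a b))) => r;
    have [+ _] := dF r a b; rewrite mxE.
by apply: (@is_derive_0_is_cst _ (fun t => complex.Im (F t a b))) => r;
  have [_ +] := dF r a b; rewrite mxE.
Qed.

(** For skew-Hermitian [X] the derivative of [E^* E] along [E = exp (s X)] is
    [E^* (X^* + X) E = 0], so [E^* E] keeps its value at [s = 0]. *)
Lemma expmx_unitary X (t : R) : X^t* = - X -> expmx (t%:C *: X) \is unitarymx.
Proof.
move=> skX.
have dE (s : R) : is_mxderive s 1 (fun s : R => (expmx (s%:C *: X))^t* *m expmx (s%:C *: X)) 0.
  apply: is_mxderive_ext (is_mxderiveM (is_mxderive_adj (expmx_is_derive X s)) (expmx_is_derive X s)) => //.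
  by rewrite trmx_mul map_mxM skX mulmxN mulNmx -mulmxA addNr.
have := is_mxderive0_cst t 0 dE.
rewrite !scale0r expmx0 mulmx1 trmx1 map_mx1 => /mulmx1C h.
by apply/unitarymxP.
Qed.

(** The equation [E' = X E] expresses the derivative linearly in [E] itself, so
    each order of differentiability gives the next. *)
Lemma smooth_expmx X : smooth_on_cmx setT (fun s : R => expmx (s%:C *: X)).
Proof.
have D t := expmx_is_derive X t.
suff C_ m a b : Ck_on m setT (fun s : R => complex.Re (expmx (s%:C *: X) a b)) /\
    Ck_on m setT (fun s : R => complex.Im (expmx (s%:C *: X) a b)).
  by move=> a b; split=> m; case: (C_ m a b).
elim: m a b => [|m IH] a b.
  split=> t _; apply: differentiable_continuous; apply/derivable1_diffP; have [h1 h2] := D t a b.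
    exact: (@ex_derive _ _ _ _ _ _ _ h1).
  exact: (@ex_derive _ _ _ _ _ _ _ h2).
have dR t : derivable (fun s : R => complex.Re (expmx (s%:C *: X) a b)) t 1.
  by have [h1 h2] := D t a b; exact: (@ex_derive _ _ _ _ _ _ _ h1).
have dI t : derivable (fun s : R => complex.Im (expmx (s%:C *: X) a b)) t 1.
  by have [h1 h2] := D t a b; exact: (@ex_derive _ _ _ _ _ _ _ h2).
have Dv (f : R -> R) v t : derivable f t 1 -> 'D_v f t = v * 'D_1 f t.
  move=> /derivable1_diffP df; rewrite !deriveE//.
  by rewrite -{1}[v]mulr1 linearZ.
split; split=> [t _|v]; try exact/derivable1_diffP.
  rewrite (_ : 'D_v _ = fun t => v * \sum_c (complex.Re (X a c) * complex.Re (expmx (t%:C *: X) c b)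
     + - complex.Im (X a c) * complex.Im (expmx (t%:C *: X) c b))).
    apply: CkM; first exact: Ck_cst.
    by apply: Ck_sum => c _; apply: CkD; (apply: CkM; first exact: Ck_cst); case: (IH c b).
  apply/funext => t; rewrite Dv//; congr (_ * _); have [h1 h2] := D t a b.
  rewrite (@derive_val _ _ _ _ _ _ _ h1) mxE cRe_sum; apply: eq_bigr => c _.
  by rewrite cReM mulNr.
rewrite (_ : 'D_v _ = fun t => v * \sum_c (complex.Re (X a c) * complex.Im (expmx (t%:C *: X) c b)
   + complex.Im (X a c) * complex.Re (expmx (t%:C *: X) c b))).
  apply: CkM; first exact: Ck_cst.
  by apply: Ck_sum => c _; apply: CkD; (apply: CkM; first exact: Ck_cst); case: (IH c b).
apply/funext => t; rewrite Dv//; congr (_ * _); have [h1 h2] := D t a b.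
rewrite (@derive_val _ _ _ _ _ _ _ h2) mxE cIm_sum; apply: eq_bigr => c _.
by rewrite cImM.
Qed.

Lemma is_cderive_prod (I : eqType) (r : seq I) (f : I -> R -> C) (d : I -> C) (t : R) :
  uniq r -> (forall i, is_cderive t (1 : R) (f i) (d i)) ->
  is_cderive t (1 : R) (fun s => \prod_(i <- r) f i s)
    (\sum_(j <- r) \prod_(i <- r) (if i == j then d i else f i t)).
Proof.
elim: r => [_ _|j r IH /= /andP[jr ur] df].
  by apply: is_cderive_ext (is_cderive_cst 1 t 1) => [y|]; rewrite big_nil.
apply: is_cderive_ext (is_cderiveM (df j) (IH ur df)) => [y|].
  by rewrite big_cons.
rewrite big_cons; congr (_ + _).
  rewrite big_cons eqxx; congr (_ * _); apply: eq_big_seq => i ir.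
  by case: eqP => // ij; rewrite -ij ir in jr.
rewrite big_distrr/=; apply: eq_big_seq => i ir; rewrite big_cons.
by case: eqP => // ij; rewrite ij ir in jr.
Qed.

(** Jacobi's formula.  Differentiating the Leibniz expansion factor by factor
    replaces one row [j] of [F t] by the row [j] of [D]; expanding the resulting
    determinant along that row gives the diagonal entry [j] of [D *m \adj (F t)]. *)
Lemma is_cderive_det (F : R -> 'M[C]_n) (D : 'M[C]_n) (t : R) :
  is_mxderive t (1 : R) F D ->
  is_cderive t (1 : R) (fun s => \det (F s)) (\tr (D *m \adj (F t))).
Proof.
move=> dF.
pose G j := \matrix_(a, b) (if a == j then D a b else F t a b).
have detG j : \det (G j) = (D *m \adj (F t)) j j.
  rewrite (expand_det_row _ j) mxE; apply: eq_bigr => c _; rewrite !mxE eqxx.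
  congr (_ * _); rewrite /cofactor; congr (_ * \det _).
  apply/matrixP => a b; rewrite !mxE; case: eqP => // /eqP.
  by rewrite eq_sym (negPf (neq_lift _ _)).
have -> : \tr (D *m \adj (F t)) = \sum_(s : {perm 'I_n}) (-1) ^+ s * \sum_j \prod_i (if i == j then D i (s i) else F t i (s i)).
  rewrite /mxtrace; under eq_bigr do rewrite -detG /determinant.
  rewrite exchange_big/=; apply: eq_bigr => s _; rewrite big_distrr/=.
  by apply: eq_bigr => j _; congr (_ * _); apply: eq_bigr => i _; rewrite mxE.
apply: is_cderive_sum => s _.
apply: is_cderive_ext (is_cderiveM (is_cderive_cst ((-1) ^+ s) t 1)
  (is_cderive_prod (index_enum_uniq _) (fun i => dF i (s i)))) => [y //|].
by rewrite mul0r add0r.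
Qed.

(** By Jacobi's formula the derivative of [det (exp (s X))] is
    [tr X * det (exp (s X))]. *)
Lemma expmx_det X (t : R) : \tr X = 0 -> \det (expmx (t%:C *: X)) = 1.
Proof.
move=> tr0.
have dd s : is_cderive s (1 : R) (fun s : R => \det (expmx (s%:C *: X))) 0.
  apply: is_cderive_ext (is_cderive_det (expmx_is_derive X s)) => //.
  by rewrite -mulmxA mul_mx_adj mul_mx_scalar mxtraceZ tr0 mulr0.
rewrite -[RHS](det1 _ n) -expmx0 -(scale0r X) -[0 in RHS]/(0%:C).
apply: complex_ext.
  by apply: (@is_derive_0_is_cst _ (fun t : R => complex.Re (\det (expmx (t%:C *: X))))) => r;
    have [] := dd r.
by apply: (@is_derive_0_is_cst _ (fun t : R => complex.Im (\det (expmx (t%:C *: X))))) => r;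
  have [] := dd r.
Qed.

Lemma expmx_SU X (t : R) : in_su X -> inSU (expmx (t%:C *: X)).
Proof. by case=> skX trX; split; [exact: expmx_unitary|exact: expmx_det]. Qed.

End Expmx.

(** * Adjoints and skew-Hermitian matrices *)

Section Adjoint.
Variable R : realType.
Local Notation C := R[i].

Lemma adjE m n (A : 'M[C]_(m, n)) i j : A^t* i j = conjc (A j i).
Proof. by rewrite !mxE. Qed.

Lemma mx_subE m n (A B : 'M[C]_(m, n)) i j : (A - B) i j = A i j - B i j.
Proof. by rewrite !mxE. Qed.

Lemma mx_addE m n (A B : 'M[C]_(m, n)) i j : (A + B) i j = A i j + B i j.
Proof. by rewrite !mxE. Qed.

Lemma mx_scaleE m n c (A : 'M[C]_(m, n)) i j : (c *: A) i j = c * A i j.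
Proof. by rewrite mxE. Qed.

Lemma adjM m n p (A : 'M[C]_(m, n)) (B : 'M[C]_(n, p)) : (A *m B)^t* = B^t* *m A^t*.
Proof. by rewrite trmx_mul map_mxM. Qed.

Lemma adjD m n (A B : 'M[C]_(m, n)) : (A + B)^t* = A^t* + B^t*.
Proof. by rewrite linearD map_mxD. Qed.

Lemma adjN m n (A : 'M[C]_(m, n)) : (- A)^t* = - A^t*.
Proof. by rewrite linearN map_mxN. Qed.

Lemma adjB m n (A B : 'M[C]_(m, n)) : (A - B)^t* = A^t* - B^t*.
Proof. by rewrite adjD adjN. Qed.

Lemma adjZ m n c (A : 'M[C]_(m, n)) : (c *: A)^t* = conjc c *: A^t*.
Proof. by apply/matrixP => i j; rewrite !mxE rmorphM. Qed.

Lemma adjZr m n (c : R) (A : 'M[C]_(m, n)) : (c%:C *: A)^t* = c%:C *: A^t*.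
Proof. by rewrite adjZ; congr (_ *: _); exact: conjc_real. Qed.

Lemma adj_sum m n I (r : seq I) (F : I -> 'M[C]_(m, n)) :
  (\sum_(i <- r) F i)^t* = \sum_(i <- r) (F i)^t*.
Proof.
elim: r => [|i r IH]; first by rewrite !big_nil trmx0 map_mx0.
by rewrite !big_cons adjD IH.
Qed.

Lemma adj1 n : (1%:M : 'M[C]_n)^t* = 1%:M.
Proof. by rewrite trmx1 map_mx1. Qed.

Lemma unitary_mulV n (a : 'M[C]_n) : a \is unitarymx -> a *m a^t* = 1%:M.
Proof. by move/unitarymxP. Qed.

Lemma unitary_Vmul n (a : 'M[C]_n) : a \is unitarymx -> a^t* *m a = 1%:M.
Proof. by move/unitarymxP/mulmx1C. Qed.

Lemma inSU_mul n (a b : 'M[C]_n) : inSU a -> inSU b -> inSU (a *m b).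
Proof.
move=> [ua da] [ub db]; split; first exact: mul_unitarymx.
by rewrite det_mulmx da db mulr1.
Qed.

Lemma inSU1 n : inSU (1%:M : 'M[C]_n).
Proof. by split; [apply/unitarymxP; rewrite adj1 mulmx1|exact: det1]. Qed.

(** For skew-Hermitian [M], [- tr (M M)] is the trace of [M] times its adjoint, the sum of the squared
    moduli of the entries. *)
Lemma skew_trace_sq n (M : 'M[C]_n) : M^t* = - M -> complex.Re (\tr (M *m M)) = 0 -> M = 0.
Proof.
move=> skM; have {2}-> : M = - M^t* by rewrite skM opprK.
rewrite mulmxN raddfN/= cReN => /eqP; rewrite oppr_eq0 => /eqP h.
apply/matrixP => i j; rewrite mxE.
have E : \tr (M *m M^t*) = \sum_i \sum_j `|M i j| ^+ 2.
  apply: eq_bigr => a _; rewrite mxE; apply: eq_bigr => b _.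
  by rewrite adjE sqr_normc.
have ge0 a b : 0 <= `|M a b| ^+ 2 by rewrite exprn_ge0.
have h0 : \tr (M *m M^t*) = 0.
  apply: complex_ext => //; apply: ger0_Im; rewrite E.
  by apply: sumr_ge0 => a _; apply: sumr_ge0.
move: h0; rewrite E => /eqP; rewrite psumr_eq0; last by move=> a _; apply: sumr_ge0.
move=> /allP/(_ i (mem_index_enum _)); rewrite psumr_eq0// => /allP/(_ j (mem_index_enum _)).
by rewrite sqrf_eq0 normr_eq0 => /eqP.
Qed.

Lemma lie_skew n (A B : 'M[C]_n) : A^t* = - A -> B^t* = - B ->
  (lie_bracket A B)^t* = - lie_bracket A B.
Proof.
by move=> sA sB; rewrite /lie_bracket adjB !adjM sA sB !mulNmx !mulmxN !opprK opprB.
Qed.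

(** The identity behind the cancellation of the vertical part [K] in the geodesic
    equation, with [Z] in the role of the image of [Y] under the metric operator:
    cyclicity of the trace moves [K] across, and only the bracket of [Y] and [Z] is
    left. *)
Lemma vertical_trace n (Z Y K W : 'M[C]_n) :
  - complex.Re (\tr ((Z *m K - K *m Z) *m W))
    - - complex.Re (\tr (Z *m lie_bracket (Y + K) W))
  = - complex.Re (\tr (lie_bracket Y Z *m W)).
Proof.
have E1 : \tr (Z *m W *m Y) = \tr (Y *m Z *m W) by rewrite mxtrace_mulC mulmxA.
have E2 : \tr (Z *m W *m K) = \tr (K *m Z *m W) by rewrite mxtrace_mulC mulmxA.
have -> : (Z *m K - K *m Z) *m W = Z *m K *m W - K *m Z *m W by rewrite mulmxBl.
have -> : lie_bracket Y Z *m W = Y *m Z *m W - Z *m Y *m W by rewrite mulmxBl.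
have -> : Z *m lie_bracket (Y + K) W =
    Z *m Y *m W + Z *m K *m W - (Z *m W *m Y + Z *m W *m K).
  by rewrite /lie_bracket mulmxBr mulmxDl !mulmxDr !mulmxA.
have trB (A B : 'M[C]_n) : \tr (A - B) = \tr A - \tr B by exact: raddfB.
have reB (a b : C) : complex.Re (a - b) = complex.Re a - complex.Re b.
  by rewrite cReD cReN.
rewrite !trB !mxtraceD E1 E2 !reB !cReD.
move: (\tr _) (\tr _) (\tr _) (\tr _) => a b c d; ring.
Qed.

Lemma adj_conjK n (h Q : 'M[C]_n) : h \is unitarymx ->
  h^t* *m (h *m Q *m h^t*) *m h = Q.
Proof.
move=> uh; rewrite !mulmxA unitary_Vmul// mul1mx -mulmxA unitary_Vmul//.
by rewrite mulmx1.
Qed.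

(** If [e = f h] with [e' = e X], then [f' = (e h^-1)'] splits in the frame [f] into
    the conjugate of [X] by [h] and the logarithmic derivative of [h^-1]. *)
Lemma frame_split n (f df h dh X : 'M[C]_n) : h \is unitarymx -> X^t* = - X ->
  dh = df^t* *m f *m h + h *m X ->
  f^t* *m df = h *m X *m h^t* + h *m dh^t*.
Proof.
move=> uh sX ->; rewrite adjD !adjM trmxCK sX mulmxDr !mulmxA unitary_mulV// mul1mx.
by rewrite mulmxN mulNmx addrC subrK.
Qed.

Lemma conj_deriv_lie n (h dh X : 'M[C]_n) : h \is unitarymx ->
  dh *m h^t* = - (h *m dh^t*) ->
  dh *m X *m h^t* + h *m X *m dh^t* =
    h *m X *m h^t* *m (h *m dh^t*) - h *m dh^t* *m (h *m X *m h^t*).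
Proof.
move=> uh e; rewrite -mulNmx -e addrC; congr (_ + _).
  by rewrite !mulmxA -(mulmxA (h *m X)) unitary_Vmul// mulmx1.
by rewrite !mulmxA -(mulmxA dh (h^t*)) unitary_Vmul// mulmx1.
Qed.

Lemma frame_mul_adj n (f a b : 'M[C]_n) : f \is unitarymx ->
  (f^t* *m a)^t* = - (f^t* *m a) ->
  a^t* *m b = - (f^t* *m a *m (f^t* *m b)).
Proof.
move=> uf e; rewrite -mulNmx -e adjM trmxCK mulmxA -(mulmxA _ f) unitary_mulV//.
by rewrite mulmx1.
Qed.

End Adjoint.

(** Differentiating the constant [F^* F = 1]. *)
Lemma unitary_deriv_skew (R : realType) (V : normedModType R) n
    (F : V -> 'M[R[i]]_n) x v D :
  (\forall y \near x, F y \is unitarymx) -> is_mxderive x v F D ->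
  ((F x)^t* *m D)^t* = - ((F x)^t* *m D).
Proof.
move=> uF dF.
have h1 := is_mxderiveM (is_mxderive_adj dF) dF.
have h2 : is_mxderive x v (fun y => (F y)^t* *m F y) 0.
  apply: is_mxderive_near (is_mxderive_cst 1%:M x v).
  by apply: filterS uF => y uy; rewrite unitary_Vmul.
have := is_mxderive_uniq h1 h2.
by rewrite adjM trmxCK => /eqP; rewrite addr_eq0 => /eqP.
Qed.

(** * The Killing form *)

Section Killing.
Variables (R : realType) (n : nat).
Local Notation C := R[i].

Lemma trace_lin_mx (f : 'M[C]_n -> 'M[C]_n) :
  \tr (lin_mx f) = \sum_i \sum_j f (delta_mx i j) i j.
Proof.
rewrite /mxtrace (reindex _ (curry_mxvec_bij _ _))/= pair_bigA/=.
apply: eq_bigr => -[i j] _ /=; rewrite !mxE /= vec_mx_delta.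
by rewrite mxvecE.
Qed.

Lemma mul_delta_mul (A B : 'M[C]_n) (i j k l : 'I_n) :
  (A *m delta_mx i j *m B) k l = A k i * B j l.
Proof.
have E c : (A *m delta_mx i j) k c = A k i * (c == j)%:R.
  rewrite mxE (bigD1 i)//= big1 ?addr0 => [|m mi]; first by rewrite mxE eqxx.
  by rewrite mxE (negPf mi) mulr0.
rewrite mxE (bigD1 j)//= big1 ?addr0 => [|m mi]; first by rewrite E eqxx mulr1.
by rewrite E (negPf mi) mulr0 mul0r.
Qed.

(** On all matrices [tr (ad A ad B) = 2 n tr (A B) - 2 tr A tr B], read off on the
    elementary matrices. *)
Lemma killingE (A B : 'M[C]_n) : \tr A = 0 -> \tr B = 0 ->
  killing A B = (n%:R *+ 2) * complex.Re (\tr (A *m B)).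
Proof.
move=> tA tB; rewrite /killing trace_lin_mx.
have -> : \sum_i \sum_j lie_bracket A (lie_bracket B (delta_mx i j)) i j =
  \sum_i \sum_j ((A *m B) i i + (B *m A) j j - (A i i * B j j + B i i * A j j)).
  apply: eq_bigr => i _; apply: eq_bigr => j _.
  have -> : lie_bracket A (lie_bracket B (delta_mx i j)) =
     (A *m B) *m delta_mx i j *m 1%:M + 1%:M *m delta_mx i j *m (B *m A)
     - (A *m delta_mx i j *m B + B *m delta_mx i j *m A).
    rewrite /lie_bracket mulmxBr mulmxBl mulmx1 mul1mx !mulmxA opprB.
    by rewrite opprD [LHS]addrACA.
  rewrite mx_subE !mx_addE !mul_delta_mul.
  by rewrite !mxE !eqxx mulr1 mul1r.
have -> : \sum_i \sum_j ((A *m B) i i + (B *m A) j j - (A i i * B j j + B i i * A j j))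
   = \tr (A *m B) *+ n + \tr (B *m A) *+ n - (\tr A * \tr B + \tr B * \tr A).
  have S (f g : 'I_n -> C) : \sum_i \sum_j f i * g j = (\sum_i f i) * (\sum_j g j).
    by rewrite mulr_suml; apply: eq_bigr => i _; rewrite mulr_sumr.
  under eq_bigr do rewrite big_split/= sumrN big_split/= big_split/= sumr_const card_ord.
  rewrite big_split/= sumrN big_split/= big_split/= !S -sumrMnl sumr_const card_ord.
  by [].
rewrite tA tB !mul0r addr0 subr0 (mxtrace_mulC B A) -mulrnDl -mulr2n -mulrnA.
have E (z : C) m : complex.Re (z *+ m) = complex.Re z *+ m by rewrite raddfMn.
by rewrite E mulrnAl mulr_natl -mulrnA mulnC.
Qed.
End Killing.

(** * Block structure and the space m *)

Section Blocks.
Variables (R : realType) (k : nat) (p : 'I_k -> nat).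
Local Notation C := R[i].
Local Notation n := (\sum_(i < k) p i)%N.
Local Notation mat := 'M[C]_n.
Implicit Types (A B Y Z : mat) (L : 'I_k -> 'I_k -> R).

(** Matrices are handled through their entries: a condition on the block [(i, j)]
    becomes a condition on the entries [(s, t)] with [blk s = i] and [blk t = j]. *)
Definition blk (s : 'I_n) : 'I_k := tagnat.sig1 s.

Lemma blk_Rank i (a : 'I_(p i)) : blk (@tagnat.Rank k p i a) = i.
Proof. exact: tagnat.Rank1K. Qed.

Lemma submxblock_entry A s t : submxblock A (blk s) (blk t) (tagnat.sig2 s) (tagnat.sig2 t) = A s t.
Proof. by rewrite !mxE !tagnat.sig2K. Qed.

Lemma block_operatorE L A s t : block_operator L A s t = (L (blk s) (blk t))%:C * A s t.
Proof. by rewrite mxE mxE submxblock_entry. Qed.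

Lemma m_partE A : m_part A = block_operator (fun i j => (i != j)%:R) A.
Proof.
apply/matrixP => s t; rewrite block_operatorE mxE -/(blk s) -/(blk t).
case: eqP => /= _; first by rewrite mxE mul0r.
by rewrite submxblock_entry mul1r.
Qed.

Lemma m_part_entry A s t : m_part A s t = if blk s == blk t then 0 else A s t.
Proof. by rewrite m_partE block_operatorE; case: eqP => _; rewrite ?mul0r ?mul1r. Qed.

Lemma block_diagonalP A : block_diagonal A <-> forall s t, blk s != blk t -> A s t = 0.
Proof.
split=> [h s t st|h i j ij].
  by rewrite -submxblock_entry h// mxE.
by apply/matrixP => a b; rewrite !mxE h// !blk_Rank.
Qed.

Lemma block_diagonal1 : block_diagonal (1%:M : mat).
Proof.
apply/block_diagonalP => s t st; rewrite mxE; have [E|//] := eqVneq s t.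
by rewrite E eqxx in st.
Qed.

Lemma block_diagonal_mul A B : block_diagonal A -> block_diagonal B -> block_diagonal (A *m B).
Proof.
move=> /block_diagonalP hA /block_diagonalP hB; apply/block_diagonalP => s t st.
rewrite mxE big1// => u _; have [su|su] := eqVneq (blk s) (blk u).
  by rewrite hB ?mulr0// -su.
by rewrite hA ?mul0r.
Qed.

Lemma block_diagonal_adj A : block_diagonal A -> block_diagonal (A^t*).
Proof.
move=> /block_diagonalP hA; apply/block_diagonalP => s t st.
by rewrite adjE hA ?conjc0// eq_sym.
Qed.

(** A block-diagonal factor on the right does not change the row block, and mixes
    columns only inside one block, where the weights are constant.  With
    [block_operator_mull], this makes block operators commute with [Ad K]. *)
Lemma block_operator_mulr L A B : block_diagonal B ->
  block_operator L (A *m B) = block_operator L A *m B.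
Proof.
move=> /block_diagonalP hB; apply/matrixP => s t; rewrite block_operatorE !mxE mulr_sumr.
apply: eq_bigr => u _; rewrite block_operatorE mulrA.
by have [->//|ut] := eqVneq (blk u) (blk t); rewrite hB// !mulr0.
Qed.

Lemma block_operator_mull L A B : block_diagonal B ->
  block_operator L (B *m A) = B *m block_operator L A.
Proof.
move=> /block_diagonalP hB; apply/matrixP => s t; rewrite block_operatorE !mxE mulr_sumr.
apply: eq_bigr => u _; rewrite block_operatorE mulrCA.
by have [->//|ut] := eqVneq (blk s) (blk u); rewrite hB// !mul0r.
Qed.

Lemma block_operator_trace L A B : (forall i j, L i j = L j i) ->
  \tr (block_operator L A *m B) = \tr (A *m block_operator L B).
Proof.
move=> sL; apply: eq_bigr => s _; rewrite !mxE; apply: eq_bigr => t _.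
by rewrite !block_operatorE mulrA [_ * A s t]mulrC (sL (blk s)).
Qed.

Lemma block_operatorD L A B : block_operator L (A + B) = block_operator L A + block_operator L B.
Proof. by apply/matrixP => s t; rewrite !(block_operatorE, mxE) mulrDr. Qed.

Lemma block_operatorZ L c A : block_operator L (c *: A) = c *: block_operator L A.
Proof. by apply/matrixP => s t; rewrite !(block_operatorE, mxE) mulrCA. Qed.

Lemma block_operatorN L A : block_operator L (- A) = - block_operator L A.
Proof. by apply/matrixP => s t; rewrite !(block_operatorE, mxE) mulrN. Qed.

Lemma block_operator_adj L A : (forall i j, L i j = L j i) ->
  (block_operator L A)^t* = block_operator L (A^t*).
Proof.
move=> sL; apply/matrixP => s t; rewrite adjE !block_operatorE adjE rmorphM/=.
by rewrite /= oppr0 sL.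
Qed.

Lemma block_operator_comp L L' A :
  block_operator L (block_operator L' A) = block_operator (fun i j => L i j * L' i j) A.
Proof. by apply/matrixP => s t; rewrite !block_operatorE mulrA rmorphM. Qed.

Lemma eq_block_operator L L' A : (forall i j, i != j -> L i j = L' i j) ->
  (forall s t, blk s = blk t -> A s t = 0) -> block_operator L A = block_operator L' A.
Proof.
move=> LL' A0; apply/matrixP => s t; rewrite !block_operatorE.
by have [st|st] := eqVneq (blk s) (blk t); [rewrite A0// !mulr0|rewrite LL'].
Qed.

Lemma m_part_block A : block_diagonal (A - m_part A).
Proof.
apply/block_diagonalP => s t st; by rewrite mx_subE m_part_entry (negPf st) subrr.
Qed.

Lemma m_part_id A : (forall s t, blk s = blk t -> A s t = 0) -> m_part A = A.
Proof.
by move=> h; apply/matrixP => s t; rewrite m_part_entry; case: eqP => // /h ->.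
Qed.

Lemma m_part_diag0 A s t : blk s = blk t -> m_part A s t = 0.
Proof. by move=> st; rewrite m_part_entry st eqxx. Qed.

Lemma trace_m_part A : \tr (m_part A) = 0.
Proof. by apply: big1 => s _; rewrite m_part_diag0. Qed.

Lemma trace_block_offdiag A B : block_diagonal A -> (forall s t, blk s = blk t -> B s t = 0) ->
  \tr (A *m B) = 0.
Proof.
move=> /block_diagonalP hA hB; apply: big1 => s _; rewrite mxE big1// => t _.
by have [st|st] := eqVneq (blk s) (blk t); [rewrite hB ?mulr0|rewrite hA ?mul0r].
Qed.

(** The diagonal blocks [D] of [A] form an element of k when [A] is in su(n), and
    orthogonality of [A] to [D] says that [tr (A D) = tr (D D)] vanishes, whence
    [D = 0].  Conversely, a product of a block-diagonal and an off-diagonal matrix has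
    zero diagonal. *)
Lemma in_mP A : in_m A <-> in_su A /\ (forall s t, blk s = blk t -> A s t = 0).
Proof.
split=> [[[skA trA] kA]|[[skA trA] A0]]; last first.
  split=> // B [[skB trB] bB].
  by rewrite killingE// mxtrace_mulC (trace_block_offdiag bB A0) mulr0.
split=> // s t st.
pose D := A - m_part A.
have bD : block_diagonal D by exact: m_part_block.
have symN i j : (i != j)%:R = (j != i)%:R :> R by rewrite eq_sym.
have skD : D^t* = - D.
  rewrite /D adjB skA m_partE block_operator_adj; last exact: symN.
  by rewrite skA block_operatorN opprB opprK addrC.
have trD : \tr D = 0 by rewrite raddfB/= trA trace_m_part subrr.
have := kA D (conj (conj skD trD) bD); rewrite killingE// => /eqP.
have n0 : (0 < n)%N by apply: leq_trans (ltn_ord s).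
rewrite mulf_eq0 mulrn_eq0/= pnatr_eq0 eqn0Ngt n0/= => /eqP h.
have D0 : D = 0.
  apply: skew_trace_sq => //; rewrite -[RHS]h; congr complex.Re.
  have -> : A *m D = D *m D + m_part A *m D by rewrite -mulmxDl subrK.
  have h0 : \tr (D *m m_part A) = 0.
    by apply: trace_block_offdiag => // ? ?; exact: m_part_diag0.
  by rewrite mxtraceD (mxtrace_mulC (m_part A) D) h0 addr0.
by have := congr1 (fun M : mat => M s t) D0; rewrite mx_subE m_part_entry st eqxx subr0 mxE.
Qed.

Lemma in_m_skew A : in_m A -> A^t* = - A.
Proof. by case=> [[]]. Qed.

Lemma in_m_diag0 A s t : in_m A -> blk s = blk t -> A s t = 0.
Proof. by move=> /in_mP[_ h]; exact: h. Qed.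

Lemma in_m_m_part A : A^t* = - A -> in_m (m_part A).
Proof.
move=> skA; apply/in_mP; split; last by move=> s t; exact: m_part_diag0.
split; last exact: trace_m_part.
rewrite m_partE block_operator_adj => [|i j]; last by rewrite eq_sym.
by rewrite skA block_operatorN.
Qed.

Lemma in_m_lin A B (c : R) : in_m A -> in_m B -> in_m (c%:C *: A + B).
Proof.
move=> /in_mP[[skA tA] A0] /in_mP[[skB tB] B0]; apply/in_mP; split; last first.
  by move=> s t st; rewrite !mxE A0// B0// mulr0 addr0.
split; last by rewrite raddfD/= mxtraceZ tA tB mulr0 addr0.
by rewrite adjD adjZr skA skB scalerN opprD.
Qed.

Lemma in_m0 : in_m (0 : mat).
Proof.
apply/in_mP; split; last by move=> s t _; rewrite mxE.
by split; [rewrite trmx0 map_mx0 oppr0|rewrite mxtrace0].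
Qed.

Lemma in_mZ A (c : R) : in_m A -> in_m (c%:C *: A).
Proof. by move=> mA; rewrite -[_ *: _]addr0; apply: in_m_lin => //; exact: in_m0. Qed.

Lemma in_m_sum I (r : seq I) (F : I -> mat) :
  (forall i, in_m (F i)) -> in_m (\sum_(i <- r) F i).
Proof.
move=> mF; elim/big_rec: _ => [|i Y _ mY]; first exact: in_m0.
by rewrite -[F i]scale1r; exact: (in_m_lin 1).
Qed.

Lemma in_m_conj h A : h \is unitarymx -> block_diagonal h -> in_m A -> in_m (h *m A *m h^t*).
Proof.
move=> uh bh mA; have bh' := block_diagonal_adj bh.
have -> : h *m A *m h^t* = m_part (h *m A *m h^t*).
  rewrite m_partE block_operator_mulr// block_operator_mull// -m_partE m_part_id//.
  by move=> s t; exact: in_m_diag0.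
apply: in_m_m_part; rewrite !adjM trmxCK (in_m_skew mA) mulNmx mulmxN mulmxA//.
Qed.

End Blocks.

(** * Invariant metrics *)

Section Scaling.
Variable R : realType.
Local Notation C := R[i].

(** A unimodular scalar, an [n]-th root of the inverse determinant, brings a unitary
    matrix into SU(n).  Conjugation does not see this scalar, so the metric is
    invariant under all block-diagonal unitary matrices, and the diagonal and
    permutation matrices below may be used without care for determinants. *)
Lemma unitary_scale_SU n (U : 'M[C]_n) : (0 < n)%N -> U \is unitarymx ->
  exists c : C, c * conjc c = 1 /\ inSU (c *: U).
Proof.
move=> n0 uU; pose c : C := n.-root (\det U)^-1.
have cn : c ^+ n = (\det U)^-1 by exact: rootCK.
have dU : \det U * conjc (\det U) = 1.
  have := congr1 determinant (unitary_mulV uU).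
  by rewrite det_mulmx det1 det_map_mx det_tr.
have dU0 : \det U != 0 by apply/eqP => h; move: dU; rewrite h mul0r => /eqP; rewrite eq_sym oner_eq0.
have cc : c * conjc c = 1.
  have h : (c * conjc c) ^+ n = 1.
    rewrite exprMn cn (_ : conjc c ^+ n = conjc (c ^+ n)); last by rewrite rmorphXn.
    by rewrite cn conjc_inv -invfM dU invr1.
  have ge0 : 0 <= c * conjc c by exact: mulcJ_ge0.
  by apply/eqP; rewrite -(pexpr_eq1 n0 ge0) h.
exists c; split; first exact: cc.
split; last by rewrite detZ cn mulVf.
apply/unitarymxP; rewrite adjZ -scalemxAl -scalemxAr scalerA cc scale1r.
exact: unitary_mulV.
Qed.

End Scaling.

Section ElementaryMatrices.
Variables (R : realType) (n : nat).
Local Notation C := R[i].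
Local Notation mat := 'M[C]_n.
Implicit Types (s t u v a b : 'I_n) (z w : C) (Y U : mat).

Lemma conjcM z w : conjc (z * w) = conjc z * conjc w. Proof. exact: rmorphM. Qed.
Lemma conjcD z w : conjc (z + w) = conjc z + conjc w. Proof. exact: rmorphD. Qed.
Lemma conjcN z : conjc (- z) = - conjc z. Proof. exact: rmorphN. Qed.

Lemma self_opp_eq0 (x : R) : - x = x -> x = 0.
Proof. by move=> h; lra. Qed.

(** For [z] in the complex numbers, these skew-Hermitian matrices run through the
    real root plane of the pair [(s, t)]. *)
Definition Emx (s t : 'I_n) (z : C) : mat := z *: delta_mx s t - conjc z *: delta_mx t s.

Lemma EmxE s t z a b : Emx s t z a b =
  z * ((a == s) && (b == t))%:R - conjc z * ((a == t) && (b == s))%:R.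
Proof. by rewrite /Emx mx_subE !mxE. Qed.

Lemma Emx0 s t : Emx s t 0 = 0.
Proof. by apply/matrixP => a b; rewrite EmxE conjc0 !mul0r subr0 mxE. Qed.

Lemma Emx_lin s t (c : R) z w : Emx s t (c%:C * z + w) = c%:C *: Emx s t z + Emx s t w.
Proof.
apply/matrixP => a b; rewrite [LHS]EmxE mx_addE mx_scaleE !EmxE conjcD conjcM conjc_real.
by ring.
Qed.

Lemma EmxZ s t (c : R) z : Emx s t (c%:C * z) = c%:C *: Emx s t z.
Proof. by rewrite -[_ * z]addr0 Emx_lin Emx0 addr0. Qed.

Lemma Emx_swap s t z : Emx t s z = Emx s t (- conjc z).
Proof. by apply/matrixP => a b; rewrite !EmxE conjcN conjcK; ring. Qed.

Lemma Emx_skew s t z : (Emx s t z)^t* = - Emx s t z.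
Proof.
apply/matrixP => a b; rewrite adjE [RHS]mxE !EmxE conjcD conjcN !conjcM conjcK !conjc_nat.
by rewrite [(b == s) && _]andbC [(b == t) && _]andbC; ring.
Qed.

Lemma sum_delta2 (f : 'I_n -> 'I_n -> C) a b :
  \sum_s \sum_t (f s t * ((a == s) && (b == t))%:R) = f a b.
Proof.
rewrite (bigD1 a)//= (bigD1 b)//= !eqxx mulr1 big1 ?addr0; last first.
  by move=> t tb; rewrite [b == t]eq_sym (negPf tb) mulr0.
rewrite big1 ?addr0// => s sa; apply: big1 => t _.
by rewrite [a == s]eq_sym (negPf sa) mulr0.
Qed.

Lemma sum_two (f : 'I_n -> 'I_n -> R) s t : s != t ->
  (forall u v, ~~ ((u == s) && (v == t)) -> ~~ ((u == t) && (v == s)) -> f u v = 0) ->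
  \sum_u \sum_v f u v = f s t + f t s.
Proof.
move=> st f0; rewrite (bigD1 s)//= (bigD1 t)//= big1 ?addr0; last first.
  by move=> v vt; apply: f0; rewrite ?(negPf vt) ?andbF ?(negPf st).
rewrite (bigD1 t) 1?eq_sym//= (bigD1 s)//= big1 ?addr0; last first.
  by move=> v vs; apply: f0; rewrite ?(negPf vs) ?andbF// eq_sym (negPf st).
rewrite big1 ?addr0// => u /andP[us ut]; apply: big1 => v _.
by apply: f0; rewrite ?(negPf us) ?(negPf ut).
Qed.

(** In the sum over ordered pairs each root plane occurs twice, for [(s, t)] and for
    [(t, s)]; this is where the factor [1 / 2] comes from. *)
Lemma Emx_sum Y : Y^t* = - Y -> Y = \sum_s \sum_t Emx s t ((2^-1)%:C * Y s t).
Proof.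
move=> skY; apply/matrixP => a b.
pose f s t : C := (2^-1)%:C * Y s t.
transitivity (\sum_s \sum_t (f s t * ((a == s) && (b == t))%:R)
  - \sum_s \sum_t (conjc (f s t) * ((b == s) && (a == t))%:R)); last first.
  rewrite summxE -sumrB; apply: eq_bigr => s _; rewrite summxE -sumrB; apply: eq_bigr => t _.
  by rewrite EmxE [(a == t) && _]andbC.
rewrite sum_delta2 (sum_delta2 (fun s t => conjc (f s t))) /f.
have := congr1 (fun M : mat => M a b) skY; rewrite adjE mxE => h.
rewrite conjcM h mulrN opprK conjc_real -mulrDl -rmorphD/=.
have -> : 2^-1 + 2^-1 = 1 :> R by field.
by rewrite mul1r.
Qed.

Definition conjU (U Y : mat) : mat := U *m Y *m U^t*.

Lemma conjU_diag (d : 'rV[C]_n) Y a b :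
  conjU (diag_mx d) Y a b = d 0 a * Y a b * conjc (d 0 b).
Proof.
rewrite /conjU mul_diag_mx mxE (bigD1 b)//= big1 ?addr0 => [|c cb].
  by rewrite adjE !mxE eqxx mulr1n.
by rewrite adjE [diag_mx _ _ _]mxE eq_sym (negPf cb) mulr0n conjc0 mulr0.
Qed.

(** These torus elements rotate the root planes of the pairs that contain [s], and
    fix the others. *)
Definition phase (s : 'I_n) (z : C) : mat := diag_mx (\row_a (if a == s then z else 1)).

Lemma phase_unitary s z : z * conjc z = 1 -> phase s z \is unitarymx.
Proof.
move=> z1; apply/unitarymxP/matrixP => a b.
have := conjU_diag (\row_a (if a == s then z else 1)) 1%:M a b.
rewrite /conjU mulmx1 => ->; rewrite !mxE.
case: (eqVneq a b) => [->|_]; last by rewrite mulr0n mulr0 mul0r.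
by case: eqP => _; rewrite mulr1n mulr1 ?z1// conjc1 mulr1.
Qed.

Lemma phase_Emx s t z w : s != t -> conjU (phase s z) (Emx s t w) = Emx s t (z * w).
Proof.
move=> st; apply/matrixP => a b; rewrite conjU_diag [RHS]EmxE EmxE ![(\row_c _) _ _]mxE conjcM (fun_if (@conjc R)) conjc1.
by case: (eqVneq a s) => [->|as_]; case: (eqVneq b s) => [->|bs];
  rewrite ?(negPf st) ?andbF ?andbT ?andTb ?andFb /=; ring.
Qed.

Lemma phase_Emx_id s u v z w : s != u -> s != v -> conjU (phase s z) (Emx u v w) = Emx u v w.
Proof.
move=> su sv; apply/matrixP => a b; rewrite conjU_diag !EmxE ![(\row_c _) _ _]mxE (fun_if (@conjc R)) conjc1.
by case: (eqVneq a s) => [->|as_]; case: (eqVneq b s) => [->|bs];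
  rewrite ?(negPf su) ?(negPf sv) ?andbF ?andFb /=; ring.
Qed.

Definition swapmx (s s' : 'I_n) : mat := perm_mx (tperm s s').

Lemma swapmx_adj s s' : (swapmx s s')^t* = swapmx s s'.
Proof.
by rewrite /swapmx tr_perm_mx tpermV; apply/matrixP => a b; rewrite !mxE; exact: conjc_nat.
Qed.

Lemma conjU_swap s s' Y a b : conjU (swapmx s s') Y a b = Y (tperm s s' a) (tperm s s' b).
Proof.
rewrite /conjU swapmx_adj /swapmx -{2}[tperm s s']tpermV -col_permE -row_permE.
by rewrite !mxE.
Qed.

Lemma swapmx_unitary s s' : swapmx s s' \is unitarymx.
Proof.
by apply/unitarymxP; rewrite swapmx_adj /swapmx -perm_mxM tperm2 perm_mx1.
Qed.

Lemma swap_Emx s s' t z : t != s -> t != s' ->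
  conjU (swapmx s s') (Emx s t z) = Emx s' t z.
Proof.
move=> ts ts'; apply/matrixP => a b; rewrite conjU_swap [LHS]EmxE [RHS]EmxE.
have E c : (tperm s s' c == s) = (c == s').
  by rewrite -(inj_eq (@perm_inj _ (tperm s s'))) tpermK tpermL.
have E' c : (tperm s s' c == t) = (c == t).
  by rewrite -(inj_eq (@perm_inj _ (tperm s s'))) tpermK tpermD// eq_sym.
by rewrite !E !E'.
Qed.

End ElementaryMatrices.

Section Schur.
Variables (R : realType) (k : nat) (p : 'I_k -> nat).
Local Notation C := R[i].
Local Notation n := (\sum_(i < k) p i)%N.
Local Notation mat := 'M[C]_n.
Local Notation blk := (@blk k p).

(** The trace form carries the metric instead of the Killing form: the two differ on
    su(n) by the factor [2 n], which the weights [L] absorb. *)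
Definition lam_form (L : 'I_k -> 'I_k -> R) (Y Z : mat) : R :=
  - complex.Re (\tr (block_operator L Y *m Z)).

Lemma lam_formE L Y Z : Z^t* = - Z -> lam_form L Y Z =
  \sum_s \sum_t L (blk s) (blk t) * complex.Re (conjc (Y s t) * Z s t).
Proof.
move=> skZ; rewrite /lam_form -cReN -raddfN/= -mulmxN -skZ cRe_sum.
apply: eq_bigr => s _; rewrite mxE cRe_sum; apply: eq_bigr => t _.
rewrite block_operatorE adjE; case: (Y s t) (Z s t) => [a b] [c d] /=; simpc => /=.
by ring.
Qed.

Lemma in_m_Emx s t z : blk s != blk t -> in_m (Emx s t z : mat).
Proof.
move=> st; apply/in_mP.
have F a b x y : blk a = blk b -> blk x != blk y -> (a == x) && (b == y) = false.
  by move=> ab xy; apply/negbTE/negP => /andP[/eqP ax /eqP yb]; rewrite -ax -yb ab eqxx in xy.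
have d0 a b : blk a = blk b -> Emx s t z a b = 0.
  by move=> ab; rewrite EmxE !F// 1?eq_sym// !mulr0 subr0.
split=> //; split; first exact: Emx_skew.
by apply: big1 => a _; exact: d0.
Qed.

Lemma phase_block s z : block_diagonal (phase s z : mat).
Proof.
apply/block_diagonalP => a b ab; rewrite mxE; case: eqP => [E|_]; last by rewrite mulr0n.
by rewrite E eqxx in ab.
Qed.

Lemma swapmx_block s s' : blk s = blk s' -> block_diagonal (swapmx R s s' : mat).
Proof.
move=> ss; apply/block_diagonalP => a b ab; rewrite !mxE.
case: eqP => // h; move: ab; rewrite -h.
by case: tpermP => [->|->|]; rewrite ?ss ?eqxx.
Qed.

Section FormClassification.
Variables (g : mat -> mat -> mat -> R) (hp : forall i, (0 < p i)%N).
Hypothesis ig : invariant_metric g.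
Let gm := ig.1.
Let q := g 1%:M.
Let su1 : inSU (1%:M : mat) := @inSU1 R n.

Lemma g_base a Y Z : inSU a -> in_m Y -> in_m Z -> g a Y Z = q Y Z.
Proof. by move=> sa mY mZ; have := ig.2 1%:M a Y Z su1 sa mY mZ; rewrite mulmx1. Qed.

Lemma q_lin (c : R) Y Y' Z : in_m Y -> in_m Y' -> in_m Z ->
  q (c%:C *: Y + Y') Z = c * q Y Z + q Y' Z.
Proof. exact: (metric_linear gm c su1). Qed.

Lemma q_sym Y Z : in_m Y -> in_m Z -> q Y Z = q Z Y.
Proof. exact: (metric_sym gm su1). Qed.

Lemma q0 Z : in_m Z -> q 0 Z = 0.
Proof.
move=> mZ; have := q_lin 1 (@in_m0 R k p) (@in_m0 R k p) mZ.
rewrite scaler0 addr0 mul1r => h; apply/eqP.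
by rewrite -(inj_eq (addrI (q 0 Z))) -h addr0.
Qed.

Lemma qD Y Y' Z : in_m Y -> in_m Y' -> in_m Z -> q (Y + Y') Z = q Y Z + q Y' Z.
Proof. by move=> mY mY' mZ; rewrite -[in LHS](scale1r Y) -[1]/(1%:C) q_lin// mul1r. Qed.

Lemma qZ (c : R) Y Z : in_m Y -> in_m Z -> q (c%:C *: Y) Z = c * q Y Z.
Proof.
by move=> mY mZ; rewrite -[_ *: _]addr0 q_lin// ?q0 ?addr0//; exact: in_m0.
Qed.

Lemma q_sum I (r : seq I) (F : I -> mat) Z : (forall i, in_m (F i)) -> in_m Z ->
  q (\sum_(i <- r) F i) Z = \sum_(i <- r) q (F i) Z.
Proof.
move=> mF mZ; elim: r => [|i r IH]; first by rewrite !big_nil q0.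
by rewrite !big_cons qD ?IH//; exact: in_m_sum.
Qed.

Lemma q_conj U Y Z : U \is unitarymx -> block_diagonal U -> in_m Y -> in_m Z ->
  q (conjU U Y) (conjU U Z) = q Y Z.
Proof.
move=> uU bU mY mZ.
(* an n-th root of the determinant needs n > 0; for n = 0 all matrices agree *)
have [n0|n0] := posnP n.
  have E (A B : mat) : A = B by apply/matrixP => s; have := ltn_ord s; rewrite {2}n0.
  by congr q; exact: E.
have [c [cc [ucU dcU]]] := unitary_scale_SU n0 uU.
have bcU : block_diagonal (c *: U).
  by apply/block_diagonalP => s t st; rewrite mxE ((block_diagonalP U).1 bU)// mulr0.
have kU : inK (c *: U) by [].
have := metric_well_defined gm su1 kU mY mZ.
rewrite mul1mx (g_base kU.1 mY mZ) => ->; rewrite -/q (invmx_unitary ucU).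
have E A : (c *: U) *m A *m (c *: U)^t* = conjU U A.
  by rewrite adjZ -scalemxAl -scalemxAl -scalemxAr scalerA cc scale1r.
by rewrite !E.
Qed.

(** Conjugation by the phase [-1] at [s] preserves the form, changes the sign of the
    first vector and fixes the second one. *)
Lemma q_Emx_orth s t u v z w : blk s != blk t -> blk u != blk v ->
  s != u -> s != v -> q (Emx s t z) (Emx u v w) = 0.
Proof.
move=> st uv su sv.
have mst := in_m_Emx z st; have muv := in_m_Emx w uv.
have st' : s != t by apply: contraNneq st => ->.
have N1 : (-1 : C) * conjc (-1) = 1 by rewrite rmorphN1 mulrNN mulr1.
have := q_conj (phase_unitary s N1) (phase_block s (-1)) mst muv.
rewrite (phase_Emx _ _ st') (phase_Emx_id _ _ su sv) mulN1r.
have -> : Emx s t (- z) = (-1)%:C *: Emx s t z.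
  by rewrite -EmxZ -[(-1)%:C]/(real_complex R (-1)) rmorphN1 mulN1r.
rewrite (qZ _ mst muv) mulN1r => h; exact: self_opp_eq0 h.
Qed.

(** Weight of the metric on the root plane of [(s, t)]; it is shown to depend on the
    blocks of [s] and [t] only. *)
Definition coef s t := q (Emx s t 1) (Emx s t 1).

(** Conjugation by the phase ['i] at [s] acts on the root plane as the rotation by a
    quarter turn, so the form on this plane is a multiple of the Euclidean one. *)
Lemma q_Emx_diag s t z w : blk s != blk t ->
  q (Emx s t z) (Emx s t w) = coef s t * complex.Re (conjc z * w).
Proof.
move=> st; have mst z' := in_m_Emx z' st.
have st' : s != t by apply: contraNneq st => ->.
pose ii : C := 'i%C.
have I1 : ii * conjc ii = 1 by rewrite /ii /=; simpc.
have cj z1 z2 := q_conj (phase_unitary s I1) (phase_block s ii) (mst z1) (mst z2).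
have e1 : conjU (phase s ii) (Emx s t 1) = Emx s t ii.
  by rewrite (phase_Emx _ _ st') mulr1.
have ei : conjU (phase s ii) (Emx s t ii) = (-1)%:C *: Emx s t 1.
  rewrite (phase_Emx _ _ st') -EmxZ; congr Emx.
  by rewrite /ii; simpc.
have qii : q (Emx s t ii) (Emx s t ii) = q (Emx s t 1) (Emx s t 1).
  exact (etrans (f_equal2 q (esym e1) (esym e1)) (cj 1 1)).
have q1i : q (Emx s t ii) ((-1)%:C *: Emx s t 1) = q (Emx s t 1) (Emx s t ii).
  exact (etrans (f_equal2 q (esym e1) (esym ei)) (cj 1 ii)).
have dec (z' : C) : Emx s t z' = (complex.Re z')%:C *: Emx s t 1 + (complex.Im z')%:C *: Emx s t ii.
  rewrite -(EmxZ _ _ _ ii) -Emx_lin; congr Emx.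
  by case: z' => a b; rewrite /ii; simpc.
have m1 := mst 1; have mi := mst ii.
rewrite /coef (dec z) (dec w) {e1 ei cj dec mst}.
move: qii q1i m1 mi; generalize (@Emx R n s t 1) (@Emx R n s t ii) => F1 Fi qii q1i m1 mi.
have {}q1i : q F1 Fi = 0.
  apply: self_opp_eq0.
  by rewrite -{2}q1i (q_sym mi (in_mZ _ m1)) (qZ _ m1 mi) mulN1r.
have dz (z1 z2 : R) Z : in_m Z ->
    q (z1%:C *: F1 + z2%:C *: Fi) Z = z1 * q F1 Z + z2 * q Fi Z.
  by move=> mF; rewrite (q_lin _ m1 (in_mZ _ mi) mF) (qZ _ mi mF).
have mzw (z1 z2 : R) : in_m (z1%:C *: F1 + z2%:C *: Fi) by apply: in_m_lin m1 (in_mZ _ mi).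
rewrite (dz _ _ _ (mzw _ _)) (q_sym m1 (mzw _ _)) (q_sym mi (mzw _ _)).
rewrite (dz _ _ _ m1) (dz _ _ _ mi) qii (q_sym mi m1) q1i.
by rewrite cReM cReJ cImJ; ring.
Qed.

(** The transposition of [s] and [s'] lies in the isotropy group when both indices
    are in the same block. *)
Lemma coef_blk s s' t : blk s = blk s' -> blk s != blk t -> coef s t = coef s' t.
Proof.
move=> ss st.
have ts : t != s by apply: contraNneq st => ->.
have ts' : t != s' by apply: contraNneq st => ->; rewrite ss.
have m1 := in_m_Emx 1 st.
have := q_conj (swapmx_unitary R s s') (swapmx_block ss) m1 m1.
rewrite (swap_Emx 1 ts ts') => h; exact (esym h).
Qed.

Lemma coef_sym s t : blk s != blk t -> coef s t = coef t s.
Proof.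
move=> st; rewrite [RHS]/coef (Emx_swap s t) (q_Emx_diag _ _ st).
by rewrite conjc1 conjcN conjc1 mulrNN mul1r /= mulr1.
Qed.

Lemma coef_gt0 s t : blk s != blk t -> 0 < coef s t.
Proof.
move=> st; apply: (metric_pos gm su1); first exact: in_m_Emx.
apply/eqP => /matrixP/(_ s t); rewrite EmxE !eqxx mxE.
have st' : s != t by apply: contraNneq st => ->.
by rewrite (negPf st') mulr0 subr0 mulr1 => /eqP; rewrite oner_eq0.
Qed.

Definition rep i : 'I_n := @tagnat.Rank k p i (Ordinal (hp i)).

Lemma blk_rep i : blk (rep i) = i. Proof. exact: blk_Rank. Qed.

Lemma coef_rep s t : blk s != blk t -> coef (rep (blk s)) (rep (blk t)) = coef s t.
Proof.
move=> st; have h1 := coef_blk (esym (blk_rep (blk s))) st.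
have st1 : blk (rep (blk s)) != blk t by rewrite blk_rep.
have ts1 : blk t != blk (rep (blk s)) by rewrite eq_sym.
have h2 := coef_sym st1.
have h3 := coef_blk (esym (blk_rep (blk t))) ts1.
have st2 : blk (rep (blk s)) != blk (rep (blk t)) by rewrite !blk_rep.
have h4 := coef_sym st2.
exact (etrans h4 (etrans (esym h3) (etrans (esym h2) (esym h1)))).
Qed.

(** Root planes are pairwise orthogonal, and on each of them the form is Euclidean up
    to a weight depending on the blocks; a pair of skew-Hermitian matrices is
    therefore evaluated plane by plane. *)
Lemma q_formula Y Z : in_m Y -> in_m Z ->
  q Y Z = lam_form (fun i j => coef (rep i) (rep j) / 2) Y Z.
Proof.
move=> mY mZ; rewrite lam_formE; last exact: in_m_skew.
pose a (Y : mat) s t := Emx s t ((2^-1)%:C * Y s t).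
have ma Y' s t : in_m Y' -> in_m (a Y' s t).
  move=> mY'; rewrite /a; have [st|st] := eqVneq (blk s) (blk t).
    by rewrite (in_m_diag0 mY' st) mulr0 Emx0; exact: in_m0.
  exact: in_m_Emx.
rewrite {1}(Emx_sum (in_m_skew mY)) q_sum//; last by move=> s; apply: in_m_sum => t; exact: ma.
apply: eq_bigr => s _; rewrite q_sum//; last by move=> t; exact: ma.
apply: eq_bigr => t _.
have [st|st] := eqVneq (blk s) (blk t).
  by rewrite (in_m_diag0 mY st) mulr0 Emx0 q0// conjc0 mul0r mulr0.
have st' : s != t by apply: contraNneq st => ->.
rewrite q_sym//; last exact: ma.
rewrite {1}(Emx_sum (in_m_skew mZ)) q_sum//; last 2 first.
- by move=> s'; apply: in_m_sum => t'; exact: ma.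
- exact: ma.
have -> : \sum_i q (\sum_t' Emx i t' ((2^-1)%:C * Z i t')) (Emx s t ((2^-1)%:C * Y s t))
  = \sum_i \sum_t' q (a Z i t') (a Y s t).
  by apply: eq_bigr => i _; rewrite q_sum//; [move=> t'; exact: ma|exact: ma].
have orth u v : ~~ ((u == s) && (v == t)) -> ~~ ((u == t) && (v == s)) -> q (a Z u v) (a Y s t) = 0.
  move=> h1 h2; have [uv|uv] := eqVneq (blk u) (blk v).
    by rewrite /a (in_m_diag0 mZ uv) mulr0 Emx0 q0//; exact: ma.
  have uv' : u != v by apply: contraNneq uv => ->.
  have [us|us] := eqVneq u s; last have [ut|ut] := eqVneq u t; last first.
  - by apply: q_Emx_orth.
  - rewrite /a [Emx u v _]Emx_swap; apply: q_Emx_orth => //; first by rewrite eq_sym.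
      by move: h2; rewrite ut eqxx.
    by rewrite -ut eq_sym.
  rewrite /a [Emx u v _]Emx_swap; apply: q_Emx_orth => //; first by rewrite eq_sym.
    by rewrite -us eq_sym.
  by move: h1; rewrite us eqxx.
rewrite (sum_two st' orth) /a (Emx_swap s t) !(q_Emx_diag _ _ st) (coef_rep st).
have := congr1 (fun M : mat => M t s) (in_m_skew mZ); rewrite adjE mxE => h.
have -> : - conjc ((2^-1)%:C * Z t s) = (2^-1)%:C * Z s t.
  by rewrite rmorphM/= oppr0 -mulrN; congr (_ * _); rewrite -(conjcK (Z s t)) h rmorphN.
case: (Y s t) (Z s t) => [y1 y2] [z1 z2]; rewrite !(cReM, cReJ, cImJ)/=.
by field.
Qed.

(** Invariance reduces the metric to a form at the base point, which is invariant
    under the isotropy group.  Phases make the root planes orthogonal and the form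
    Euclidean on each of them; permutations inside the blocks identify the weights. *)
Lemma invariant_metric_lam : exists L : 'I_k -> 'I_k -> R,
  (forall i j, i != j -> 0 < L i j /\ L i j = L j i) /\
  (forall a Y Z, inSU a -> in_m Y -> in_m Z -> g a Y Z = lam_form L Y Z).
Proof.
exists (fun i j => coef (rep i) (rep j) / 2); split.
  move=> i j ij; split; first by rewrite divr_gt0// coef_gt0// !blk_rep.
  by rewrite coef_sym ?blk_rep.
by move=> a Y Z sa mY mZ; rewrite g_base// q_formula.
Qed.

End FormClassification.

End Schur.

Section LamMetric.
Variables (R : realType) (k : nat) (p : 'I_k -> nat).
Local Notation C := R[i].
Local Notation n := (\sum_(i < k) p i)%N.
Local Notation mat := 'M[C]_n.

(** The form does not depend on the point, so smoothness is trivial and invariance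
    under K holds because block operators commute with [Ad K]. *)
Lemma lam_form_invariant (L : 'I_k -> 'I_k -> R) :
  (forall i j, i != j -> 0 < L i j /\ L i j = L j i) ->
  invariant_metric (fun _ : mat => lam_form (p := p) L).
Proof.
move=> hL; split=> //; split.
- move=> a Y Y' Z c _ _ _ _; rewrite /lam_form block_operatorD block_operatorZ.
  by rewrite mulmxDl -scalemxAl mxtraceD mxtraceZ cReD cReM/= mul0r subr0 opprD mulrN.
- move=> a Y Z _ mY mZ; rewrite !lam_formE; [|exact: in_m_skew..].
  apply: eq_bigr => s _; apply: eq_bigr => t _.
  by congr (_ * _); rewrite !cReM !cReJ !cImJ; ring.
- move=> a Y _ mY Y0; rewrite lam_formE; last exact: in_m_skew.
  have ge0 s t : 0 <= L (blk s) (blk t) * complex.Re (conjc (Y s t) * Y s t).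
    have [st|st] := eqVneq (blk s) (blk t).
      by rewrite (in_m_diag0 mY st) mulr0 mulr0.
    apply: mulr_ge0; first by apply: ltW; case: (hL _ _ st).
    by rewrite cReM cReJ cImJ mulNr opprK -!expr2 addr_ge0 ?sqr_ge0.
  rewrite lt_neqAle; apply/andP; split; last by apply: sumr_ge0 => s _; apply: sumr_ge0.
  rewrite eq_sym; apply: contraNneq Y0 => h; apply/eqP/matrixP => s t; rewrite mxE.
  move: h => /eqP; rewrite psumr_eq0; last by move=> ? _; apply: sumr_ge0.
  move=> /allP/(_ s (mem_index_enum _)); rewrite psumr_eq0// => /allP/(_ t (mem_index_enum _)).
  have [st|st] := eqVneq (blk s) (blk t); first by rewrite (in_m_diag0 mY st).
  rewrite mulf_eq0 gt_eqF/=; last by case: (hL _ _ st).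
  rewrite cReM cReJ cImJ mulNr opprK -!expr2 paddr_eq0 ?sqr_ge0// !sqrf_eq0.
  by case: (Y s t) => y1 y2 /= /andP[/eqP -> /eqP ->].
- move=> a h Y Z _ [[uh _] bh] mY mZ; rewrite /lam_form invmx_unitary//.
  rewrite block_operator_mulr; last exact: block_diagonal_adj.
  rewrite block_operator_mull//.
  rewrite -!mulmxA [h^t* *m (h *m _)]mulmxA unitary_Vmul// mul1mx.
  by rewrite [in RHS]mxtrace_mulC -!mulmxA unitary_Vmul// mulmx1.
- by move=> N U phi Y Z _ _ _ _ _; exact: smooth_cst.
Qed.

End LamMetric.

(** * The geodesic equation with a lowered index *)

Section Lowering.
Variables (R : realType) (N : nat).

(** The geodesic equation multiplied by the Gram matrix: the inverse of [h] in the
    Christoffel symbols disappears. *)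
Definition lowered_geodesic (h : 'rV[R]_N -> 'M[R]_N) (x : R -> 'rV[R]_N) (t : R) (l : 'I_N) : R :=
  \sum_c h (x t) l c * derive1 (derive1 (fun s => x s 0 c)) t
  + \sum_a \sum_b 2^-1 * (partial a (fun y => h y b l) (x t)
       + partial b (fun y => h y a l) (x t) - partial l (fun y => h y a b) (x t))
      * derive1 (fun s => x s 0 a) t * derive1 (fun s => x s 0 b) t.

Lemma geodesic_lowered h x t : h (x t) \in unitmx ->
  geodesic_eq_at h x t <-> (forall l, lowered_geodesic h x t l = 0).
Proof.
move=> uh.
pose acc : 'cV[R]_N := \col_c derive1 (derive1 (fun s => x s 0 c)) t.
pose w : 'cV[R]_N := \col_l \sum_a \sum_b 2^-1 * (partial a (fun y => h y b l) (x t)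
       + partial b (fun y => h y a l) (x t) - partial l (fun y => h y a b) (x t))
      * derive1 (fun s => x s 0 a) t * derive1 (fun s => x s 0 b) t.
have E1 : geodesic_eq_at h x t <-> acc + invmx (h (x t)) *m w = 0.
  have E c : (acc + invmx (h (x t)) *m w) c 0 = derive1 (derive1 (fun s => x s 0 c)) t
    + \sum_a \sum_b christoffel h (x t) c a b * derive1 (fun s => x s 0 a) t
        * derive1 (fun s => x s 0 b) t.
    rewrite mxE; congr (_ + _); first by rewrite mxE.
    rewrite mxE; under eq_bigr => l _ do rewrite [w l 0]mxE mulr_sumr.
    rewrite exchange_big; apply: eq_bigr => a _.
    under eq_bigr => l _ do rewrite mulr_sumr.
    rewrite exchange_big; apply: eq_bigr => b _.
    rewrite /christoffel mulr_sumr !mulr_suml; apply: eq_bigr => l _.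
    by rewrite !mulrA [2^-1 * _]mulrC.
  split=> [h0|h0 c].
    by apply/colP => c; rewrite E h0 mxE.
  by have := congr1 (fun M : 'cV[R]_N => M c 0) h0; rewrite /= E mxE.
have E2 l : lowered_geodesic h x t l = (h (x t) *m acc + w) l 0.
  by rewrite mxE; congr (_ + _); rewrite mxE//; apply: eq_bigr => c _; rewrite [acc c 0]mxE.
have E3 : h (x t) *m (acc + invmx (h (x t)) *m w) = h (x t) *m acc + w.
  by rewrite mulmxDr mulKVmx.
rewrite E1; split=> [h0 l|h0].
  by rewrite E2 -E3 h0 mulmx0 mxE.
have : h (x t) *m (acc + invmx (h (x t)) *m w) = 0.
  by rewrite E3; apply/colP => l; rewrite -E2 h0 mxE.
by move/(congr1 (mulmx (invmx (h (x t))))); rewrite mulKmx// mulmx0.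
Qed.

(** Contraction with the symmetric [v a * v b] sees only the symmetric part of the
    coefficients, so the two halves obtained by exchanging [a] and [b] agree. *)
Lemma symmetrize_sum (v : 'I_N -> R) (F G D : 'I_N -> 'I_N -> R) :
  \sum_a \sum_b 2^-1 * (F b a + G b a + (F a b + G a b) - (D b a + D a b)) * v a * v b
  = \sum_a \sum_b v a * v b * (F a b + (G a b - D a b)).
Proof.
pose H a b := v a * v b * (F a b + (G a b - D a b)).
transitivity (\sum_a \sum_b (2^-1 * H a b + 2^-1 * H b a)).
  by apply: eq_bigr => a _; apply: eq_bigr => b _; rewrite /H; ring.
transitivity (2^-1 * (\sum_a \sum_b H a b) + 2^-1 * (\sum_a \sum_b H b a)).
  rewrite !mulr_sumr -big_split; apply: eq_bigr => a _ /=.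
  by rewrite !mulr_sumr -big_split.
rewrite [X in _ + _ * X]exchange_big /= -mulrDl.
have -> : 2^-1 + 2^-1 = 1 :> R by field.
by rewrite mul1r.
Qed.

Lemma unitmx_ker0 (H : 'M[R]_N) : (forall u : 'rV[R]_N, u *m H = 0 -> u = 0) -> H \in unitmx.
Proof.
move=> h; rewrite -row_free_unit -kermx_eq0; apply/eqP/row_matrixP => i.
by rewrite row0; apply: h; rewrite -row_mul mulmx_ker row0.
Qed.

End Lowering.

(** * The metric as a degenerate form on all matrices *)

Section Beta.
Variables (R : realType) (k : nat) (p : 'I_k -> nat).
Local Notation C := R[i].
Local Notation n := (\sum_(i < k) p i)%N.
Local Notation mat := 'M[C]_n.
Variable L : 'I_k -> 'I_k -> R.
Hypothesis symL : forall i j, L i j = L j i.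
Hypothesis diagL : forall i, L i i = 0.
Implicit Types A B D : mat.
Local Notation Lam := (@block_operator R k p L).
Local Notation beta := (@lam_form R k p L).

Lemma betaDl A B D : beta (A + B) D = beta A D + beta B D.
Proof. by rewrite /lam_form block_operatorD mulmxDl mxtraceD cReD opprD. Qed.

Lemma betaZl (c : R) A B : beta (c%:C *: A) B = c * beta A B.
Proof. by rewrite /lam_form block_operatorZ -scalemxAl mxtraceZ cReM/= mul0r subr0 mulrN. Qed.

Lemma beta_sym A B : beta A B = beta B A.
Proof. by rewrite /lam_form block_operator_trace// mxtrace_mulC. Qed.

Lemma beta0l B : beta 0 B = 0.
Proof. by rewrite -(scale0r 0) (betaZl 0) mul0r. Qed.

Lemma beta_suml I (r : seq I) (F : I -> mat) B :
  beta (\sum_(i <- r) F i) B = \sum_(i <- r) beta (F i) B.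
Proof.
elim: r => [|i r IH]; first by rewrite !big_nil beta0l.
by rewrite !big_cons betaDl IH.
Qed.

Lemma betaDr A B D : beta A (B + D) = beta A B + beta A D.
Proof. by rewrite beta_sym betaDl !(beta_sym A). Qed.

Lemma betaZr (c : R) A B : beta A (c%:C *: B) = c * beta A B.
Proof. by rewrite beta_sym betaZl beta_sym. Qed.

Lemma betaNr A B : beta A (- B) = - beta A B.
Proof. by rewrite -scaleN1r -[X in X *: _](rmorphN1 (real_complex R)) betaZr mulN1r. Qed.

Lemma beta_sumr I (r : seq I) (F : I -> mat) A :
  beta A (\sum_(i <- r) F i) = \sum_(i <- r) beta A (F i).
Proof. by rewrite beta_sym beta_suml; apply: eq_bigr => i _; rewrite beta_sym. Qed.

Lemma Lam_m_part A : Lam (m_part A) = Lam A.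
Proof.
rewrite m_partE block_operator_comp; apply/matrixP => s t; rewrite !block_operatorE.
by congr (_%:C * _); case: eqVneq => [->|_]; rewrite ?diagL ?mulr0 ?mulr1.
Qed.

Lemma Lam_block A : block_diagonal A -> Lam A = 0.
Proof.
move=> /block_diagonalP h; apply/matrixP => s t; rewrite block_operatorE mxE.
by have [->|st] := eqVneq (blk s) (blk t); rewrite ?diagL ?mul0r// h// mulr0.
Qed.

Lemma beta_m_partl A B : beta (m_part A) B = beta A B.
Proof. by rewrite /lam_form Lam_m_part. Qed.

Lemma beta_m_part A B : beta (m_part A) (m_part B) = beta A B.
Proof. by rewrite beta_m_partl beta_sym beta_m_partl beta_sym. Qed.

Lemma is_mxderive_block (V : normedModType R) (F : V -> mat) x v D :
  is_mxderive x v F D -> is_mxderive x v (fun y => Lam (F y)) (Lam D).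
Proof.
move=> h a b.
have h1 := is_cderiveM (is_cderive_cst ((L (blk a) (blk b))%:C) x v) (h a b).
apply: is_cderive_ext h1 => [y|]; first by rewrite block_operatorE.
by rewrite block_operatorE mul0r add0r.
Qed.

Lemma is_derive_beta (V : normedModType R) (F G : V -> mat) x v D E :
  is_mxderive x v F D -> is_mxderive x v G E ->
  is_derive x v (fun y => beta (F y) (G y)) (beta D (G x) + beta (F x) E).
Proof.
move=> hF hG.
have [h _] := is_mxderive_trace (is_mxderiveM (is_mxderive_block hF) hG).
apply: is_derive_ext (is_deriveN h) => // .
by rewrite mxtraceD cReD opprD.
Qed.

(** Block operators commute with the bracket by a block-diagonal [K] and annihilate
    [K] itself.  What remains is a trace identity in which [K] drops out; it expresses
    the invariance of the form under the isotropy algebra. *)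
Lemma beta_vertical_cancel (Y K W : mat) : block_diagonal K ->
  beta (Y *m K - K *m Y) W - beta (Y + K) (lie_bracket (Y + K) W)
  = - complex.Re (\tr (lie_bracket Y (Lam Y) *m W)).
Proof.
move=> bK; rewrite /lam_form !block_operatorD block_operatorN.
rewrite block_operator_mulr// block_operator_mull// (Lam_block bK) addr0.
exact: vertical_trace.
Qed.

(** On diagonal blocks the bracket only pairs entries of [A] in opposite blocks, whose
    weights agree by symmetry. *)
Lemma lie_Lam_diag0 A s t : blk s = blk t -> lie_bracket A (Lam A) s t = 0.
Proof.
move=> st; rewrite /lie_bracket mx_subE !mxE -sumrB; apply: big1 => u _.
by rewrite !block_operatorE st (symL (blk t)) mulrCA mulrA subrr.
Qed.

Lemma lie_Lam_conj h A : h \is unitarymx -> block_diagonal h ->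
  lie_bracket (h *m A *m h^t*) (Lam (h *m A *m h^t*)) = h *m lie_bracket A (Lam A) *m h^t*.
Proof.
move=> uh bh; rewrite block_operator_mulr; last exact: block_diagonal_adj.
rewrite block_operator_mull//.
have V (M P : mat) : h *m M *m h^t* *m (h *m P *m h^t*) = h *m (M *m P) *m h^t*.
  by rewrite !mulmxA -(mulmxA (h *m M)) (unitary_Vmul uh) mulmx1.
by rewrite /lie_bracket !V mulmxBr mulmxBl.
Qed.

Lemma lie_Lam_in_m A : in_m A -> in_m (lie_bracket A (Lam A)).
Proof.
move=> mA; apply/in_mP; split; last by move=> s t; exact: lie_Lam_diag0.
split; last by apply: big1 => s _; exact: lie_Lam_diag0.
apply: lie_skew; first exact: in_m_skew.
by rewrite block_operator_adj// (in_m_skew mA) block_operatorN.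
Qed.

End Beta.

(** * Velocities in a lifted chart *)

Section CoordinateVelocity.
Variables (R : realType) (k : nat) (p : 'I_k -> nat).
Local Notation n := (\sum_(i < k) p i)%N.
Local Notation mat := 'M[R[i]]_n.
Variables (N : nat) (U : set 'rV[R]_N) (phi : 'rV[R]_N -> mat).
Hypothesis oU : open U.
Hypothesis sphi : smooth_on_cmx U phi.
Hypothesis uphi : forall y, U y -> inSU (phi y).

(** The component along the [a]-th coordinate of the pull-back by [phi] of the
    left-invariant Maurer-Cartan form. *)
Definition mc_form (a : 'I_N) (y : 'rV[R]_N) : mat :=
  (phi y)^t* *m derive_cmx phi y (delta_mx 0 a).

Lemma mc_form_skew y v : U y ->
  ((phi y)^t* *m derive_cmx phi y v)^t* = - ((phi y)^t* *m derive_cmx phi y v).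
Proof.
move=> Uy; apply: unitary_deriv_skew (smooth_is_mxderive v sphi Uy).
have : nbhs y U by exact: open_nbhs_nbhs.
by apply: filterS => z /uphi[].
Qed.

Lemma coord_velocityE y v : U y ->
  coord_velocity phi y v = m_part ((phi y)^t* *m derive_cmx phi y v).
Proof. by move=> Uy; rewrite /coord_velocity (invmx_unitary (uphi Uy).1). Qed.

Lemma coord_velocity_in_m y v : U y -> in_m (coord_velocity phi y v).
Proof. by move=> Uy; rewrite coord_velocityE//; apply: in_m_m_part; exact: mc_form_skew. Qed.

Lemma coord_velocity_sum y (u : 'rV[R]_N) : U y ->
  coord_velocity phi y u = m_part (\sum_a (u 0 a)%:C *: mc_form a y).
Proof.
move=> Uy; rewrite coord_velocityE// derive_cmx_dir; last first.
  by move=> a b; exact: smooth_cmx_diff sphi Uy.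
by rewrite mulmx_sumr; congr m_part; apply: eq_bigr => a _; rewrite -scalemxAr.
Qed.

End CoordinateVelocity.

(** * The geodesic equation along a one-parameter group *)

Section Core.
Variables (R : realType) (k : nat) (p : 'I_k -> nat).
Local Notation C := R[i].
Local Notation n := (\sum_(i < k) p i)%N.
Local Notation mat := 'M[C]_n.
Variable L : 'I_k -> 'I_k -> R.
Hypothesis hL : forall i j, i != j -> 0 < L i j /\ L i j = L j i.

(** Weight zero on the diagonal blocks makes the form blind to vertical vectors, so
    that it may be applied to the Maurer-Cartan form itself instead of its m-part;
    differentiating then involves no projection. *)
Definition L0 i j := if i == j then 0 else L i j.

Lemma L0_sym i j : L0 i j = L0 j i.
Proof. by rewrite /L0 eq_sym; case: eqVneq => // ij; have [] := hL ij. Qed.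

Lemma L0_diag i : L0 i i = 0. Proof. by rewrite /L0 eqxx. Qed.

Lemma L0_L (Y : mat) : in_m Y -> block_operator L Y = block_operator L0 Y.
Proof.
move=> mY; apply: eq_block_operator => [i j ij|s t]; first by rewrite /L0 (negPf ij).
exact: in_m_diag0.
Qed.

Lemma lam_form_L0 (Y Z : mat) : in_m Y -> lam_form L Y Z = lam_form L0 Y Z.
Proof. by move=> mY; rewrite /lam_form L0_L. Qed.

Lemma lam_form_eq0 (Y : mat) : in_m Y -> lam_form L Y Y = 0 -> Y = 0.
Proof.
move=> mY h; apply/eqP; apply/negPn/negP => Y0.
have := metric_pos (lam_form_invariant p hL).1 (@inSU1 R n) mY Y0.
by rewrite h ltxx.
Qed.

Variables (g : mat -> mat -> mat -> R) (N : nat) (U : set 'rV[R]_N) (phi : 'rV[R]_N -> mat).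
Hypothesis gE : forall a Y Z, inSU a -> in_m Y -> in_m Z -> g a Y Z = lam_form L Y Z.
Hypothesis lc : local_coordinates U phi.
Local Notation Lam := (@block_operator R k p L0).
Local Notation beta := (@lam_form R k p L0).

Let oU := coords_open lc.
Let sphi := coords_smooth lc.
Let uphi := @coords_SU _ _ _ _ _ _ lc.
Let dphi a y := derive_cmx phi y (delta_mx 0 a).
Local Notation om := (mc_form phi).

Lemma phi_unitary y : U y -> phi y \is unitarymx.
Proof. by move=> Uy; have [] := coords_SU lc Uy. Qed.

Lemma phi_deriv y v : U y -> is_mxderive y v phi (derive_cmx phi y v).
Proof. exact: smooth_is_mxderive. Qed.

Lemma metric_coordE y a b : U y ->
  metric_in_coordinates g phi y a b = beta (om a y) (om b y).
Proof.
move=> Uy; rewrite mxE gE; [|exact: uphi|exact: (coord_velocity_in_m oU sphi uphi)..].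
rewrite lam_form_L0; last exact: (coord_velocity_in_m oU sphi uphi).
rewrite !(coord_velocityE uphi)// beta_m_part//; [exact: L0_sym|exact: L0_diag].
Qed.

Lemma dphi_diff y c a b : U y -> differentiable (fun y => complex.Re (dphi c y a b)) y /\
  differentiable (fun y => complex.Im (dphi c y a b)) y.
Proof. by move=> Uy; exact: smooth_cmx_diff (smooth_derive_cmx _ sphi) Uy. Qed.

(** A vector in the kernel of the Gram matrix has a velocity of norm zero, and a chart
    is an immersion. *)
Lemma metric_coord_unit y : U y -> metric_in_coordinates g phi y \in unitmx.
Proof.
move=> Uy; apply: unitmx_ker0 => u uH.
apply: (coords_inj lc Uy); set Y := coord_velocity phi y u.
have mY : in_m Y by exact: (coord_velocity_in_m oU sphi uphi).
apply: lam_form_eq0 => //; rewrite lam_form_L0// /Y (coord_velocity_sum sphi uphi)//.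
rewrite beta_m_part; [|exact: L0_sym|exact: L0_diag].
rewrite beta_sumr; last exact: L0_sym.
apply: big1 => b _; rewrite betaZr; last exact: L0_sym.
rewrite beta_suml; have := congr1 (fun M : 'rV[R]_N => M 0 b) uH; rewrite !mxE => h.
rewrite (_ : \sum_i _ = 0) ?mulr0// -[RHS]h; apply: eq_bigr => a _.
by rewrite betaZl metric_coordE.
Qed.

Let ddphi y a b := derive_cmx (dphi a) y (delta_mx 0 b).
Let dom y a b : mat := (dphi b y)^t* *m dphi a y + (phi y)^t* *m ddphi y a b.

Lemma om_deriv y a b : U y -> is_mxderive y (delta_mx 0 b) (om a) (dom y a b).
Proof.
move=> Uy; apply: is_mxderiveM; first exact: is_mxderive_adj (phi_deriv _ Uy).
exact: smooth_is_mxderive (smooth_derive_cmx _ sphi) Uy.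
Qed.

(** The structure equation: the second derivatives of [phi] cancel by symmetry, and
    the products of first derivatives are products of the Maurer-Cartan components. *)
Lemma maurer_cartan y l b : U y ->
  dom y l b - dom y b l = - lie_bracket (om b y) (om l y).
Proof.
move=> Uy.
have ddE : ddphi y l b = ddphi y b l.
  by rewrite /ddphi /dphi; exact: derive_cmx_swap oU Uy sphi.
have E a c : (dphi a y)^t* *m dphi c y = - (om a y *m om c y).
  exact: frame_mul_adj (phi_unitary Uy) (mc_form_skew oU sphi uphi _ Uy).
have S (A B D : mat) : A + D - (B + D) = A - B by rewrite opprD addrACA subrr addr0.
rewrite /dom ddE S (E b l) (E l b) /lie_bracket.
by rewrite opprK opprB addrC.
Qed.

Lemma partial_metric y a b c : U y ->
  partial c (fun y => metric_in_coordinates g phi y a b) y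
   = beta (dom y a c) (om b y) + beta (om a y) (dom y b c).
Proof.
move=> Uy; rewrite /partial.
have h := is_derive_beta L0 (om_deriv a c Uy) (om_deriv b c Uy).
rewrite -(@derive_val _ _ _ _ _ _ _ h); apply: near_eq_derive.
have : nbhs y U by exact: open_nbhs_nbhs.
by apply: filterS => z Uz; rewrite metric_coordE.
Qed.

Section Curve.
Variables (X : mat) (J : set R) (x : R -> 'rV[R]_N).
Hypothesis mX : in_m X.
Hypothesis oJ : open J.
Hypothesis sx : forall c, smooth_on J (fun t => x t 0 c).
Hypothesis xU : forall t, J t -> U (x t) /\ coset (expmx (t%:C *: X)) = coset (phi (x t)).

Let vel a t := derive1 (fun s => x s 0 a) t.
Let acc a t := derive1 (derive1 (fun s => x s 0 a)) t.
Let Ex t := expmx (t%:C *: X).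
(* the isotropy factor in exp (t X) = phi (x t) * hK t *)
Let hK t : mat := (phi (x t))^t* *m Ex t.

Lemma x_derivable t c : J t -> derivable (fun s => x s 0 c) t 1.
Proof. by move=> Jt; apply/derivable1_diffP; exact: smooth_on_diff (sx c) Jt. Qed.

Lemma vel_is_derive t c : J t -> is_derive t (1 : R) (vel c) (acc c t).
Proof.
move=> Jt.
have E : vel c = 'D_1 (fun s => x s 0 c) by apply/funext => s; rewrite /vel derive1E.
have d : derivable (vel c) t 1.
  rewrite E; apply/derivable1_diffP.
  have h := smooth_on_diff (smooth_onD1 (1 : R) (sx c)) Jt; exact h.
rewrite /acc derive1E; exact: derivableP.
Qed.

(* phi^-1 phi' along the curve, and below its derivative W' *)
Let W t : mat := \sum_a (vel a t)%:C *: om a (x t).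

Lemma curve_deriv t : J t ->
  is_mxderive t (1 : R) (fun s => phi (x s)) (\sum_a (vel a t)%:C *: dphi a (x t)).
Proof.
move=> Jt; have [Ux _] := xU Jt; apply: is_mxderive_curve => [a b|c].
  exact: smooth_cmx_diff sphi Ux.
exact: x_derivable.
Qed.

Lemma hK_inK t : J t -> inK (hK t).
Proof.
move=> Jt; have [Ux E] := xU Jt.
have : coset (Ex t) (Ex t).
  exists 1%:M; last by rewrite mulmx1.
  split; first exact: inSU1.
  exact: block_diagonal1.
rewrite /Ex E => -[h kh he]; rewrite /hK /Ex -he mulmxA.
by rewrite (unitary_Vmul (phi_unitary Ux)) mul1mx.
Qed.

Lemma hK_unitary t : J t -> hK t \is unitarymx.
Proof. by move=> Jt; case: (hK_inK Jt) => -[]. Qed.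

Lemma hK_block t : J t -> block_diagonal (hK t).
Proof. by move=> Jt; case: (hK_inK Jt). Qed.

Let fd t : mat := \sum_a (vel a t)%:C *: dphi a (x t).
Let hK' t : mat := (fd t)^t* *m Ex t + (phi (x t))^t* *m (X *m Ex t).

Lemma hK_deriv t : J t -> is_mxderive t (1 : R) hK (hK' t).
Proof.
move=> Jt; apply: is_mxderiveM; first exact: is_mxderive_adj (curve_deriv Jt).
exact: expmx_is_derive.
Qed.

(** [hK] has vanishing off-diagonal blocks on the open set [J], hence so has its
    derivative. *)
Lemma hK'_block t : J t -> block_diagonal (hK' t).
Proof.
move=> Jt; apply/block_diagonalP => s u su.
have h1 := hK_deriv Jt s u.
have h2 : is_cderive t (1 : R) (fun r => hK r s u) 0.
  apply: is_cderive_near (is_cderive_cst 0 t 1).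
  have : nbhs t J by exact: open_nbhs_nbhs.
  by apply: filterS => r Jr; rewrite ((block_diagonalP _).1 (hK_block Jr)).
exact: is_cderive_uniq h1 h2.
Qed.

(* horizontal and vertical parts of W *)
Let Y t : mat := hK t *m X *m (hK t)^t*.
Let K t : mat := hK t *m (hK' t)^t*.

Lemma W_fd t : W t = (phi (x t))^t* *m fd t.
Proof.
by rewrite /W /fd mulmx_sumr; apply: eq_bigr => a _; rewrite -scalemxAr.
Qed.

Lemma W_split t : J t -> W t = Y t + K t.
Proof.
move=> Jt; have [Ux _] := xU Jt; rewrite W_fd.
have Ef : Ex t = phi (x t) *m hK t.
  by rewrite /hK mulmxA (unitary_mulV (phi_unitary Ux)) mul1mx.
have h'E : hK' t = (fd t)^t* *m phi (x t) *m hK t + hK t *m X.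
  rewrite /hK' {1}Ef mulmxA; congr (_ + _).
  by rewrite /Ex expmx_comm mulmxA.
exact: frame_split (hK_unitary Jt) (in_m_skew mX) h'E.
Qed.

Lemma K_block t : J t -> block_diagonal (K t).
Proof.
move=> Jt; apply: block_diagonal_mul; first exact: hK_block.
by apply: block_diagonal_adj; exact: hK'_block.
Qed.

Lemma Y_in_m t : J t -> in_m (Y t).
Proof. by move=> Jt; apply: in_m_conj; [exact: hK_unitary|exact: hK_block|]. Qed.

Lemma K_adj t : J t -> hK' t *m (hK t)^t* = - K t.
Proof.
move=> Jt.
have h1 := is_mxderiveM (hK_deriv Jt) (is_mxderive_adj (hK_deriv Jt)).
have h2 : is_mxderive t (1 : R) (fun r => hK r *m (hK r)^t*) 0.
  apply: is_mxderive_near (is_mxderive_cst 1%:M t 1).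
  have : nbhs t J by exact: open_nbhs_nbhs.
  by apply: filterS => r Jr; rewrite (unitary_mulV (hK_unitary Jr)).
by have := is_mxderive_uniq h1 h2 => /eqP; rewrite addr_eq0 => /eqP.
Qed.

Lemma Y_deriv t : J t -> is_mxderive t (1 : R) Y (Y t *m K t - K t *m Y t).
Proof.
move=> Jt.
have h := is_mxderiveM (is_mxderiveM (hK_deriv Jt) (is_mxderive_cst X t 1))
  (is_mxderive_adj (hK_deriv Jt)).
apply: is_mxderive_ext h => //.
rewrite mulmx0 addr0.
exact: conj_deriv_lie (hK_unitary Jt) (K_adj Jt).
Qed.

Let W' t : mat := \sum_a ((acc a t)%:C *: om a (x t)
   + (vel a t)%:C *: \sum_b (vel b t)%:C *: dom (x t) a b).

Lemma W_deriv t : J t -> is_mxderive t (1 : R) W (W' t).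
Proof.
move=> Jt; have [Ux _] := xU Jt.
apply: is_mxderive_sum => a _.
apply: is_mxderiveZ; first exact: vel_is_derive.
have hP : is_mxderive t (1 : R) (fun s => dphi a (x s)) (\sum_b (vel b t)%:C *: ddphi (x t) a b).
  apply: is_mxderive_curve => [c d|c]; first exact: dphi_diff.
  exact: x_derivable.
have h := is_mxderiveM (is_mxderive_adj (curve_deriv Jt)) hP.
apply: is_mxderive_ext h => // .
have -> : (\sum_b (vel b t)%:C *: dphi b (x t))^t* = \sum_b (vel b t)%:C *: (dphi b (x t))^t*.
  by rewrite adj_sum; apply: eq_bigr => b _; rewrite adjZr.
rewrite mulmx_suml mulmx_sumr -big_split/=; apply: eq_bigr => b _.
by rewrite -scalemxAl -scalemxAr -scalerDr.
Qed.

(** The m-part of [W] is [Y], so its derivative is also the one of the conjugate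
    [h X h^-1]. *)
Lemma m_part_W' t : J t -> m_part (W' t) = Y t *m K t - K t *m Y t.
Proof.
move=> Jt.
have h1 : is_mxderive t (1 : R) (fun s => m_part (W s)) (m_part (W' t)).
  apply: is_mxderive_ext (is_mxderive_block _ (W_deriv Jt)) => [s|]; by rewrite m_partE.
have h2 : is_mxderive t (1 : R) (fun s => m_part (W s)) (Y t *m K t - K t *m Y t).
  apply: is_mxderive_near (Y_deriv Jt).
  have : nbhs t J by exact: open_nbhs_nbhs.
  apply: filterS => r Jr; rewrite W_split// m_partE block_operatorD -!m_partE.
  rewrite m_part_id; last by move=> s u; exact: in_m_diag0 (Y_in_m Jr).
  suff -> : m_part (K r) = 0 by rewrite addr0.
  by rewrite m_partE (Lam_block _ (K_block Jr))// => i; rewrite eqxx.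
exact: is_mxderive_uniq h1 h2.
Qed.

(** The Euler-Arnold form of the geodesic equation.  Differentiating the Gram matrix
    [beta (om a) (om b)] gives derivatives of the Maurer-Cartan components; those in
    which [l] is the direction of differentiation combine with those in which it is
    not through the structure equation, and leave a bracket. *)
Lemma lowered_beta t l : J t ->
  lowered_geodesic (metric_in_coordinates g phi) x t l
  = beta (W' t) (om l (x t)) - beta (W t) (lie_bracket (W t) (om l (x t))).
Proof.
move=> Jt; have [Ux _] := xU Jt.
rewrite /lowered_geodesic -/(acc _ t).
have sL := L0_sym.
have -> : \sum_c metric_in_coordinates g phi (x t) l c * acc c t
   = \sum_c acc c t * beta (om c (x t)) (om l (x t)).
  apply: eq_bigr => c _; rewrite (metric_coordE _ _ Ux) mulrC.
  exact (f_equal ( *%R (acc c t)) (beta_sym sL (om l (x t)) (om c (x t)))).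
pose F a b := beta (dom (x t) a b) (om l (x t)).
pose G a b := beta (om a (x t)) (dom (x t) l b).
pose D a b := beta (om a (x t)) (dom (x t) b l).
have p1 a b : partial a (fun y => metric_in_coordinates g phi y b l) (x t) = F b a + G b a.
  exact: partial_metric.
have p2 a b : partial l (fun y => metric_in_coordinates g phi y a b) (x t) = D b a + D a b.
  exact (etrans (partial_metric a b l Ux) (f_equal (+%R^~ (D a b)) (beta_sym sL (dom (x t) a l) (om b (x t))))).
have -> : \sum_a \sum_b 2^-1 * (partial a (fun y => metric_in_coordinates g phi y b l) (x t)
   + partial b (fun y => metric_in_coordinates g phi y a l) (x t)
   - partial l (fun y => metric_in_coordinates g phi y a b) (x t)) * vel a t * vel b t
  = \sum_a \sum_b vel a t * vel b t * (F a b + (G a b - D a b)).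
  rewrite -symmetrize_sum; apply: eq_bigr => a _; apply: eq_bigr => b _.
  by rewrite (p1 a b) (p1 b a) (p2 a b).
have GD a b : G a b - D a b = - beta (om a (x t)) (lie_bracket (om b (x t)) (om l (x t))).
  by rewrite /G /D -(betaNr sL) -(betaDr sL) (maurer_cartan l b Ux) (betaNr sL).
have bW : beta (W t) (lie_bracket (W t) (om l (x t))) =
    \sum_a \sum_b vel a t * vel b t * beta (om a (x t)) (lie_bracket (om b (x t)) (om l (x t))).
  have lieW A B : lie_bracket (\sum_b (vel b t)%:C *: A b) B = \sum_b (vel b t)%:C *: lie_bracket (A b) B :> mat.
    rewrite /lie_bracket mulmx_suml mulmx_sumr -sumrN -big_split; apply: eq_bigr => b _ /=.
    by rewrite -scalemxAl -scalemxAr scalerBr.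
  rewrite {1}/W beta_suml; apply: eq_bigr => a _.
  rewrite betaZl /W lieW (beta_sumr sL) mulr_sumr; apply: eq_bigr => b _.
  by rewrite (betaZr sL) mulrA.
have -> : \sum_a \sum_b vel a t * vel b t * (F a b + (G a b - D a b)) =
   \sum_a \sum_b vel a t * vel b t * F a b - beta (W t) (lie_bracket (W t) (om l (x t))).
  rewrite bW -sumrB; apply: eq_bigr => a _.
  rewrite -sumrB; apply: eq_bigr => b _.
  rewrite GD; exact: mulrBr.
suff -> : beta (W' t) (om l (x t)) = \sum_c acc c t * beta (om c (x t)) (om l (x t))
    + \sum_a \sum_b vel a t * vel b t * F a b by rewrite addrA.
rewrite /W' beta_suml -big_split; apply: eq_bigr => a _ /=.
rewrite betaDl !betaZl beta_suml mulr_sumr; congr (_ + _); apply: eq_bigr => b _.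
by rewrite betaZl mulrA.
Qed.

(** The isotropy factor contributes to [W] and to its derivative, but
    [beta_vertical_cancel] removes both contributions, and what is left is conjugate to
    the bracket of [X] with its image. *)
Lemma lowered_lie t l : J t ->
  lowered_geodesic (metric_in_coordinates g phi) x t l
  = - complex.Re (\tr (hK t *m lie_bracket X (Lam X) *m (hK t)^t* *m om l (x t))).
Proof.
move=> Jt; rewrite lowered_beta// -beta_m_partl; last exact: L0_diag.
rewrite m_part_W'// W_split// beta_vertical_cancel; [|exact: L0_diag|exact: K_block].
by rewrite lie_Lam_conj//; [exact: hK_unitary|exact: hK_block].
Qed.

(** The bracket of [X] and [Lam X] lies in m, because its diagonal blocks vanish, and so does
    its conjugate [M] by the isotropy factor.  As the velocities of a chart span m, the
    vanishing of all pairings of [M] with the coordinate directions makes the norm of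
    [M] zero. *)
Lemma geodesic_eq_lie t : J t ->
  geodesic_eq_at (metric_in_coordinates g phi) x t <-> lie_bracket X (Lam X) = 0.
Proof.
move=> Jt; have [Ux _] := xU Jt.
rewrite geodesic_lowered; last exact: metric_coord_unit.
split=> [h|h l]; last by rewrite lowered_lie// h mulmx0 !mul0mx mxtrace0 oppr0.
set Q := lie_bracket X _.
pose M := hK t *m Q *m (hK t)^t*.
have mQ : in_m Q := @lie_Lam_in_m R k p L0 L0_sym X mX.
have mM : in_m M by apply: in_m_conj; [exact: hK_unitary|exact: hK_block|].
have [u uE] := coords_surj lc Ux mM.
have M0 : M = 0.
  apply: skew_trace_sq; first exact: in_m_skew.
  have -> : \tr (M *m M) = \tr (M *m \sum_a (u 0 a)%:C *: om a (x t)).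
    rewrite -{2}uE (coord_velocity_sum sphi uphi)// m_partE -block_operator_trace; last by move=> i j; rewrite eq_sym.
    by rewrite -m_partE m_part_id// => s v; exact: in_m_diag0.
  have -> : \tr (M *m \sum_a (u 0 a)%:C *: om a (x t)) = \sum_a \tr (M *m ((u 0 a)%:C *: om a (x t))).
    by rewrite mulmx_sumr raddf_sum.
  rewrite cRe_sum; apply: big1 => a _.
  have := h a; rewrite lowered_lie// -/Q -/M => /eqP; rewrite oppr_eq0 => /eqP h0.
  by rewrite -scalemxAr mxtraceZ cReM/= h0 mulr0 mul0r subr0.
have := adj_conjK Q (hK_unitary Jt); rewrite -/M M0 mulmx0 mul0mx => Q0.
exact (esym Q0).
Qed.

End Curve.

End Core.

(** * Products of exponentials of linear forms *)

Section LinForm.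
Variables (R : realType) (N : nat).

Definition linform (l : 'I_N -> R) (x : 'rV[R]_N) : R := \sum_a l a * x 0 a.

Lemma is_derive_coord (b : 'I_N) (x : 'rV[R]_N) v :
  is_derive x v (fun y : 'rV[R]_N => y 0 b) (v 0 b).
Proof.
have d : differentiable (fun y : 'rV[R]_N => y 0 b) x by exact: differentiable_coord.
have := @derive_mx _ _ _ _ (fun y : 'rV[R]_N => y) x v (@derivable_id R _ x v).
rewrite derive_id => /matrixP/(_ 0 b); rewrite mxE => ->.
by apply: derivableP; exact: diff_derivable.
Qed.

Lemma linform_differentiable l x : differentiable (linform l) x.
Proof.
rewrite (_ : linform l = \sum_a (fun x : 'rV[R]_N => l a * x 0 a)).
  apply: differentiable_sum => a; apply: differentiableZ; exact: differentiable_coord.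
by apply/funext => y; rewrite fct_sumE.
Qed.

Lemma linform_derive l x v : 'D_v (linform l) x = linform l v.
Proof.
rewrite (_ : linform l = \sum_a (fun x : 'rV[R]_N => l a * x 0 a)); last first.
  by apply/funext => y; rewrite fct_sumE.
have h := @is_derive_sum R _ _ N (fun a (x : 'rV[R]_N) => l a * x 0 a) x v (fun a => l a * v 0 a)
  (fun a => is_deriveZ (l a) (is_derive_coord a x v)).
by rewrite (@derive_val _ _ _ _ _ _ _ h) fct_sumE.
Qed.

Lemma linformZ l (c : R) x : linform l (c *: x) = c * linform l x.
Proof. by rewrite /linform mulr_sumr; apply: eq_bigr => a _; rewrite mxE mulrCA. Qed.

End LinForm.

Section Factors.
Variables (R : realType) (N n : nat).
Local Notation C := R[i].
Local Notation mat := 'M[C]_n.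
Local Notation form := ('I_N -> R).

Definition expf (f : form * mat) (x : 'rV[R]_N) : mat := expmx ((linform f.1 x)%:C *: f.2).

Definition expprod (fs : seq (form * mat)) (x : 'rV[R]_N) : mat :=
  foldr (fun f M => expf f x *m M) 1%:M fs.

Lemma expf_smooth f : smooth_on_cmx setT (expf f).
Proof.
move=> a b; have [h1 h2] := smooth_expmx f.2 a b; split.
  apply: (@smooth_comp_form _ _ (linform f.1) _ _ _ h1) => [x|x v].
    exact: linform_differentiable.
  exact: linform_derive.
apply: (@smooth_comp_form _ _ (linform f.1) _ _ _ h2) => [x|x v].
  exact: linform_differentiable.
exact: linform_derive.
Qed.

Lemma expprod_smooth fs : smooth_on_cmx setT (expprod fs).
Proof.
elim: fs => [|f fs IH]; first exact: smooth_mx_cst.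
exact: smooth_mxM (expf_smooth f) IH.
Qed.

Lemma expprod_SU fs x : (forall f, f \in map snd fs -> in_su f) -> inSU (expprod fs x).
Proof.
elim: fs => [_|f fs IH h] /=; first exact: inSU1.
apply: inSU_mul; first by apply: expmx_SU; apply: h; rewrite mem_head.
by apply: IH => f' f'fs; apply: h; rewrite inE f'fs orbT.
Qed.

Lemma expf_deriv f x v :
  is_mxderive x v (expf f) ((linform f.1 v)%:C *: (f.2 *m expf f x)).
Proof.
have sE := expf_smooth f.
have h : is_mxderive x v (expf f) (derive_cmx (expf f) x v) by exact: smooth_is_mxderive sE I.
apply: is_mxderive_ext h => //; apply/matrixP => a b; rewrite mxE mx_scaleE.
have [d1 d2] := expmx_is_derive f.2 (linform f.1 x) a b.
have [s1 s2] := smooth_expmx f.2 a b.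
apply: complex_ext; rewrite ?cReM ?cImM/= mul0r ?subr0 ?addr0.
  have := derive_comp_form v (linform_differentiable f.1 x) (smooth_on_diff s1 I).
  by rewrite linform_derive (@derive_val _ _ _ _ _ _ _ d1).
have := derive_comp_form v (linform_differentiable f.1 x) (smooth_on_diff s2 I).
by rewrite linform_derive (@derive_val _ _ _ _ _ _ _ d2).
Qed.

Lemma sum_delta_frame (e : 'I_N -> mat) a :
  \sum_b ((delta_mx 0 a : 'rV[R]_N) 0 b)%:C *: e b = e a.
Proof.
rewrite (bigD1 a)//= mxE !eqxx scale1r big1 ?addr0// => b ba.
by rewrite mxE (negPf ba) andbF scale0r.
Qed.

Lemma expprod_at0 fs x : (forall f, f \in map fst fs -> linform f x = 0) -> expprod fs x = 1%:M.
Proof.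
elim: fs => [//|f fs IH h] /=.
rewrite IH; last by move=> f' f'fs; apply: h; rewrite inE f'fs orbT.
by rewrite /expf h ?mem_head// scale0r expmx0 mulmx1.
Qed.

(** At a common zero of the forms all factors are the identity, so their differentials
    add up. *)
Lemma expprod_deriv0 fs x v : (forall f, f \in map fst fs -> linform f x = 0) ->
  is_mxderive x v (expprod fs) (\sum_(f <- fs) (linform f.1 v)%:C *: f.2).
Proof.
elim: fs => [_|f fs IH h].
  rewrite big_nil; exact: is_mxderive_cst.
have h' f' : f' \in map fst fs -> linform f' x = 0.
  by move=> f'fs; apply: h; rewrite inE f'fs orbT.
rewrite big_cons; have := is_mxderiveM (expf_deriv f x v) (IH h').
rewrite (expprod_at0 h').
have -> : expf f x = 1%:M by rewrite /expf h ?mem_head// scale0r expmx0.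
by rewrite !mulmx1 mul1mx; apply: is_mxderive_ext.
Qed.

End Factors.

(** * A basis of m *)

Section Basis.
Variables (R : realType) (k : nat) (p : 'I_k -> nat).
Local Notation C := R[i].
Local Notation n := (\sum_(i < k) p i)%N.
Local Notation mat := 'M[C]_n.

Definition spans_m N (e : 'I_N -> mat) : Prop :=
  (forall a, in_m (e a)) /\
  (forall Y, in_m Y -> exists c : 'I_N -> R, Y = \sum_a (c a)%:C *: e a).

Lemma spans_m_Emx : exists N (e : 'I_N -> mat), spans_m e.
Proof.
pose T : finType := ('I_n * 'I_n * bool)%type.
pose F (q : T) : mat := if blk q.1.1 != blk q.1.2 then Emx q.1.1 q.1.2 (if q.2 then 'i%C else 1) else 0.
exists #|T|, (fun a => F (enum_val a)); split=> [a|Y mY].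
  rewrite /F; case: ifPn => h; last exact: in_m0.
  exact: in_m_Emx.
pose c (q : T) : R := if q.2 then 2^-1 * complex.Im (Y q.1.1 q.1.2) else 2^-1 * complex.Re (Y q.1.1 q.1.2).
exists (fun a => c (enum_val a)).
transitivity (\sum_(q : T) (c q)%:C *: F q); last first.
  rewrite [RHS](reindex (@enum_rank T)); last first.
    by exists enum_val => ? _; [exact: enum_rankK|exact: enum_valK].
  by apply: eq_bigr => q _; rewrite enum_rankK.
rewrite {1}(Emx_sum (in_m_skew mY)) pair_bigA /=.
transitivity (\sum_(q : 'I_n * 'I_n) \sum_(b : bool) (c (q, b))%:C *: F (q, b)); last first.
  by rewrite pair_bigA /=; apply: eq_bigr => -[q b] _.
apply: eq_bigr => -[s t] _ /=; rewrite big_bool /c /F /=.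
have [st|st] := eqVneq (blk s) (blk t).
  by rewrite (in_m_diag0 mY st) mulr0 Emx0 !scaler0 addr0.
rewrite /= -!EmxZ addrC.
rewrite [X in _ = X + _]EmxZ -Emx_lin; congr Emx.
case: (Y s t) => y1 y2; simpc => //=.
Qed.

Lemma spans_m_drop N (e : 'I_N.+1 -> mat) (c : 'I_N.+1 -> R) b :
  spans_m e -> \sum_a (c a)%:C *: e a = 0 -> c b != 0 -> spans_m (fun a => e (lift b a)).
Proof.
move=> [me se] ce cb; split=> [a|Y /se[y ->]]; first exact: me.
exists (fun a => y (lift b a) - y b * (c b)^-1 * c (lift b a)).
have eb : e b = - ((c b)^-1)%:C *: \sum_a (c (lift b a))%:C *: e (lift b a).
  move: ce; rewrite (bigD1_ord b)//= => /eqP; rewrite addr_eq0 => /eqP h.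
  by rewrite scaleNr -scalerN -h scalerA -rmorphM/= mulVf// scale1r.
rewrite (bigD1_ord b)//= {1}eb scaler_sumr scaler_sumr -big_split; apply: eq_bigr => a _ /=.
rewrite !scalerA -scalerDl; congr (_ *: _).
by rewrite rmorphB !rmorphM/=; ring.
Qed.

(** A spanning family of minimal length is free, since a linear relation would allow
    one vector to be dropped. *)
Lemma ex_basis_m : exists N (e : 'I_N -> mat), spans_m e /\
  (forall c : 'I_N -> R, \sum_a (c a)%:C *: e a = 0 -> forall a, c a = 0).
Proof.
have [N0 [e0 s0]] := spans_m_Emx.
have exN : exists N, `[< exists e : 'I_N -> mat, spans_m e >].
  by exists N0; apply/asboolP; exists e0.
have [N /asboolP[e se] minN] := ex_minnP exN.
exists N, e; split=> // c ce b; apply/eqP/negPn/negP => cb.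
case: N => [|N] in e se minN c ce b cb *; first by case: b cb.
have := minN N; rewrite ltnn => /(_ _)/negP; apply=> //.
by apply/asboolP; exists (fun a => e (lift b a)); exact: spans_m_drop se ce cb.
Qed.

End Basis.

(** * A chart containing the curve *)

Section Chart.
Variables (R : realType) (k : nat) (p : 'I_k -> nat).
Local Notation C := R[i].
Local Notation n := (\sum_(i < k) p i)%N.
Local Notation mat := 'M[C]_n.

Definition offdiag (i j : 'I_k) : R := (i != j)%:R.

Lemma offdiag_sym i j : offdiag i j = offdiag j i.
Proof. by rewrite /offdiag eq_sym. Qed.

Lemma offdiag_diag i : offdiag i i = 0.
Proof. by rewrite /offdiag eqxx. Qed.

Lemma offdiag_hL i j : i != j -> 0 < offdiag i j /\ offdiag i j = offdiag j i.
Proof. by move=> ij; split; [rewrite /offdiag ij ltr01|exact: offdiag_sym]. Qed.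

Local Notation beta := (@lam_form R k p offdiag).

Lemma smooth_lam_form (V : normedModType R) (L : 'I_k -> 'I_k -> R) (F : V -> mat) (B : mat) :
  smooth_on_cmx setT F -> smooth_on setT (fun x => lam_form L (F x) B).
Proof.
move=> sF.
rewrite (_ : (fun _ => _) = fun x => - \sum_s \sum_t
   (L (blk s) (blk t) * (complex.Re (F x s t) * complex.Re (B t s)
       + - (complex.Im (F x s t) * complex.Im (B t s))))).
  apply: smoothN; apply: smooth_sum => s _; apply: smooth_sum => t _.
  have [h1 h2] := sF s t.
  apply: smoothM; first exact: smooth_cst.
  apply: smoothD; last apply: smoothN; apply: smoothM => //; exact: smooth_cst.
apply/funext => x; rewrite /lam_form /mxtrace cRe_sum; congr (- _).
apply: eq_bigr => s _; rewrite mxE cRe_sum; apply: eq_bigr => t _.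
by rewrite block_operatorE -mulrA cReM/= mul0r subr0 cReM.
Qed.

Section FrameChart.
Variables (N : nat) (e : 'I_N -> mat) (phi : 'rV[R]_N -> mat).
Hypothesis se : spans_m e.
Hypothesis fe : forall c : 'I_N -> R, \sum_a (c a)%:C *: e a = 0 -> forall a, c a = 0.
Hypothesis sphi : smooth_on_cmx setT phi.
Hypothesis uphi : forall x, inSU (phi x).

Let openT' : open (setT : set 'rV[R]_N) := openT.
Let uphiT y : setT y -> inSU (phi y) := fun _ => uphi y.
Local Notation velocity := (mc_form phi).

(** Pairing with a basis of m reads the velocities as coordinate vectors, so that
    [phi] defines a chart exactly where this matrix is invertible. *)
Definition framemx (y : 'rV[R]_N) : 'M[R]_N := \matrix_(a, b) beta (velocity a y) (e b).

Definition chart_domain : set 'rV[R]_N := [set y | \det (framemx y) != 0].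

Lemma chart_domain_open : open chart_domain.
Proof.
have sd : smooth_on setT (fun y => \det (framemx y)).
  apply: smooth_det => a b.
  rewrite (_ : (fun _ => _) = fun y => beta (velocity a y) (e b)); last first.
    by apply/funext => y; rewrite mxE.
  apply: smooth_lam_form; apply: smooth_mxM; first exact: smooth_mx_adj.
  exact: smooth_derive_cmx.
have := @open_comp _ _ (fun y : 'rV[R]_N => \det (framemx y)) [set z | z != 0].
apply; last exact: open_neq.
by move=> y _; exact: (sd 0%N y I).
Qed.

Lemma beta_velocity y u b : beta (coord_velocity phi y u) (e b) = (u *m framemx y) 0 b.
Proof.
rewrite (coord_velocity_sum sphi uphiT)// beta_m_partl; last exact: offdiag_diag.
rewrite beta_suml mxE; apply: eq_bigr => a _.
by rewrite betaZl mxE.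
Qed.

Lemma beta_nondeg Z : in_m Z -> (forall b, beta Z (e b) = 0) -> Z = 0.
Proof.
move=> mZ h; apply: (lam_form_eq0 offdiag_hL mZ).
have [c {2}->] := se.2 Z mZ.
rewrite (beta_sumr offdiag_sym); apply: big1 => b _.
by rewrite (betaZr offdiag_sym) h mulr0.
Qed.

Lemma frame_chart : local_coordinates chart_domain phi.
Proof.
split.
- exact: chart_domain_open.
- by move=> a b; have [h1 h2] := sphi a b; split; [apply: smooth_on_sub h1|apply: smooth_on_sub h2].
- by move=> x _; exact: uphi.
- move=> y u Uy uy.
  have uF : framemx y \in unitmx by rewrite unitmxE unitfE.
  apply: (can_inj (mulmxK uF)); rewrite mul0mx; apply/rowP => b.
  by rewrite -beta_velocity uy beta0l mxE.
- move=> y Y Uy mY.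
  have uF : framemx y \in unitmx by rewrite unitmxE unitfE.
  pose r : 'rV[R]_N := \row_b beta Y (e b).
  exists (r *m invmx (framemx y)).
  apply/eqP; rewrite -subr_eq0; apply/eqP.
  have N1 : forall A : mat, - A = (-1)%:C *: A.
    by move=> A; rewrite -scaleN1r -[X in X *: _](rmorphN1 (real_complex R)).
  apply: beta_nondeg.
    rewrite N1 addrC; apply: in_m_lin => //; exact: (coord_velocity_in_m openT' sphi uphiT).
  move=> b; rewrite betaDl N1 betaZl beta_velocity mulmxKV// mxE.
  by rewrite mulN1r subrr.
Qed.

Lemma chart_domain_frame y : (forall v, derive_cmx phi y v = phi y *m \sum_a (v 0 a)%:C *: e a) ->
  chart_domain y.
Proof.
move=> h; rewrite /chart_domain/=.
have vE a : velocity a y = e a.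
  by rewrite /mc_form h mulmxA (unitary_Vmul (uphi y).1) mul1mx sum_delta_frame.
rewrite -unitfE -unitmxE; apply: unitmx_ker0 => u uF.
apply/rowP => a; rewrite mxE.
apply: (fe (c := fun a => u 0 a)).
apply: beta_nondeg.
  by apply: in_m_sum => b; apply: in_mZ; exact: se.1.
move=> b; have := congr1 (fun M : 'rV[R]_N => M 0 b) uF; rewrite !mxE => <-.
by rewrite beta_suml; apply: eq_bigr => c _; rewrite betaZl mxE vE.
Qed.

End FrameChart.

(** Write [X] as the combination with coordinates [xi] of a basis [e] of m, and choose
    a linear form [sg] with [sg xi = 1].  The product of [exp (sg x X)] with the
    [exp ((x a - sg x * xi a) e a)] is a chart: on the line spanned by [xi] all the forms
    except [sg] vanish, so [t *: xi] is sent to [exp (t X)], and the differential there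
    sends [v] to [sg v * X] plus the sum of the [(v a - sg v * xi a) e a], that is to the
    vector of m with coordinates [v].  For [X = 0], [xi = 0] and [sg = 0] serve the same
    purpose. *)
Lemma geodesic_chart (X : mat) : in_m X ->
  exists (N : nat) (U : set 'rV[R]_N) (phi : 'rV[R]_N -> mat) (x : R -> 'rV[R]_N),
    [/\ local_coordinates U phi, forall c, smooth_on setT (fun t => x t 0 c),
        forall t, U (x t) & forall t, phi (x t) = expmx (t%:C *: X)].
Proof.
move=> mX.
have [N [e [se fe]]] := ex_basis_m R p.
have [xi [sg [Xxi sgE]]] : exists (xi : 'rV[R]_N) (sg : 'I_N -> R),
    X = \sum_a (xi 0 a)%:C *: e a /\ (linform sg xi = 1 \/ X = 0 /\ xi = 0).
  have [c Xc] := se.2 X mX; have [X0|X0] := eqVneq X 0.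
    exists 0, (fun=> 0); split; last by right.
    by rewrite X0; symmetry; apply: big1 => a _; rewrite mxE scale0r.
  have [b cb] : exists b, c b != 0.
    apply/existsP; rewrite -negb_forall; apply: contra X0 => /forallP c0.
    rewrite Xc; apply/eqP; apply: big1 => a _; have /eqP -> := c0 a.
    by rewrite scale0r.
  exists (\row_a c a), (fun a => (a == b)%:R / c b); split.
    by rewrite {1}Xc; apply: eq_bigr => a _; rewrite mxE.
  left; rewrite /linform (bigD1 b)//= big1 ?addr0.
    by rewrite eqxx mxE mul1r mulVf.
  by move=> a ab; rewrite (negPf ab) !mul0r.
pose ff a : ('I_N -> R) * mat := ((fun c => (c == a)%:R - xi 0 a * sg c), e a).
pose fs := [seq ff a | a <- index_enum 'I_N].
pose phi := expprod ((sg, X) :: fs).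
have ffE a v : linform (ff a).1 v = v 0 a - xi 0 a * linform sg v.
  rewrite /linform mulr_sumr [X in X - _](_ : _ = \sum_c (c == a)%:R * v 0 c).
    by rewrite -sumrB; apply: eq_bigr => c _; rewrite mulrBl mulrA.
  rewrite (bigD1 a)//= big1 ?addr0 ?eqxx ?mul1r// => c ca.
  by rewrite (negPf ca) mul0r.
have sphi : smooth_on_cmx setT phi by exact: expprod_smooth.
have uphi x : inSU (phi x).
  apply: expprod_SU => A /=; rewrite inE => /orP[/eqP ->|]; first by case: mX.
  by rewrite -map_comp => /mapP[a _ ->]; case: (se.1 a).
pose x (t : R) : 'rV[R]_N := t *: xi.
have sgx t : (linform sg (x t))%:C *: X = t%:C *: X.
  rewrite linformZ; case: sgE => [->|[-> _]]; first by rewrite mulr1.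
  by rewrite !scaler0.
have fs0 t f : f \in map fst fs -> linform f (x t) = 0.
  rewrite -map_comp => /mapP[a _ ->].
  transitivity (linform (ff a).1 (x t)); first by [].
  rewrite ffE linformZ mxE.
  case: sgE => [->|[_ ->]]; first by rewrite mulr1 mulrC subrr.
  by rewrite mxE mulr0 mul0r subrr.
have phix t : phi (x t) = expmx (t%:C *: X).
  by rewrite /phi /= (expprod_at0 (fs0 t)) mulmx1 /expf /= sgx.
exists N, (chart_domain e phi), phi, x; split=> //.
- exact: frame_chart.
- move=> c; rewrite (_ : (fun _ => _) = fun t : R => t * xi 0 c); last first.
    by apply/funext => t; rewrite mxE.
  apply: smoothM; last exact: smooth_cst.
  exact: smooth_id.
- move=> t; apply: (chart_domain_frame se fe uphi) => v.
  apply: derive_cmxE.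
  have := is_mxderiveM (expf_deriv (sg, X) (x t) v) (expprod_deriv0 v (fs0 t)).
  rewrite (expprod_at0 (fs0 t)) mulmx1 => h.
  apply: is_mxderive_ext h => [//|].
  (* the exponential of X commutes with X, so it factors out on the left *)
  have pull (c : R[i]) (A B S : mat) :
    A *m B = B *m A -> c *: (A *m B) + B *m S = B *m (c *: A + S).
    by move=> ->; rewrite scalemxAr mulmxDr.
  have expfE : expf (sg, X) (x t) = expmx (t%:C *: X) by rewrite /expf /= sgx.
  rewrite phix expfE big_map /= pull; last exact: expmx_comm.
  congr (_ *m _).
  rewrite [X in _ *: X + _]Xxi scaler_sumr -big_split; apply: eq_bigr => a _ /=.
  by rewrite scalerA -scalerDl -rmorphM -rmorphD ffE; congr (_%:C *: _); ring.
Qed.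

End Chart.

(** * Equigeodesic vectors *)

Theorem theorem1p1 (R : realType) (k : nat) (p : 'I_k -> nat)
    (hk : (0 < k)%N) (hp : forall i, (0 < p i)%N)
    (X : 'M[R[i]]_(\sum_(i < k) p i)) (hX : in_m X) :
  equigeodesic_vector X <->
  (forall Lam : 'M[R[i]]_(\sum_(i < k) p i) -> 'M[R[i]]_(\sum_(i < k) p i),
     invariant_metric_operator Lam ->
     m_part (lie_bracket X (Lam X)) = 0%R).
Proof.
split=> [eq Lam [lam [hlam Lamlam]]|h g ig t0].
  have ig := lam_form_invariant p hlam.
  have [N [U [phi [J [x [lc [oJ J0] sx xU geo]]]]]] := eq _ ig 0.
  have Q0 := (geodesic_eq_lie hlam (fun _ _ _ _ _ _ => erefl) lc hX oJ sx xU J0).1 (geo 0 J0).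
  rewrite (Lamlam _ hX) L0_L// Q0 m_partE.
  by apply/matrixP => s t; rewrite block_operatorE !mxE mulr0.
have [L [hL gE]] := invariant_metric_lam hp ig.
have [N [U [phi [x [lc sx xU phix]]]]] := geodesic_chart hX.
exists N, U, phi, setT, x.
have xU' t : setT t -> U (x t) /\ coset (expmx (t%:C *: X)) = coset (phi (x t)).
  by move=> _; split; [exact: xU|rewrite phix].
split=> //; first by split=> //; exact: openT.
move=> t _; apply/(geodesic_eq_lie hL gE lc hX openT sx xU' I).
have op : invariant_metric_operator (block_operator (p := p) L) by exists L.
have := h _ op; rewrite (L0_L _ hX) m_part_id => [Q0|s u su]; first exact Q0.
exact: (lie_Lam_diag0 (L0_sym hL) X su).
Qed.
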